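(* Let $n\ge 1$, $1<p<\infty$, $p\neq 2$. Let $\lambda:\mathbb{R}^n\to(0,\infty)$ be continuous and bounded and let $\psi=(\psi_1,\dots,\psi_n)$ with each $\psi_j:\mathbb{R}^n\to(0,\infty)$ continuous. For $\xi\in\mathbb{R}^n$ put $$S(\xi)=\{\eta\in\mathbb{R}^n:\ \psi_j(\eta)\le\psi_j(\xi),\ j=1,\dots,n\}.$$ Assume that there are positive constants $c,C$, independent of $\xi$, such that for every $\xi\in\mathbb{R}^n$ with $|\xi|\ge C$ there exists an $n$-dimensional interval $$I(\xi)=\{\eta\in\mathbb{R}^n:\ |\eta_j|\le l_j(\xi),\ j=1,\dots,n\}$$ with $l_j(\xi)\in\mathbb{R}$, $l_j(\xi)\ge c\,\psi_j(\xi)$ for $j=1,\dots,n$, and $$I(\xi)\subseteq S(\xi),\qquad \mu(S(\xi))\le C\,\mu(I(\xi)),$$ where $\mu$ is Lebesgue measure on $\mathbb{R}^n$. Assume that the function $$F_p(\xi)=\Bigl(\inf_{\eta\in S(\xi)}\lambda(\eta)\Bigr)\Bigl(\mu(S(\xi))\prod_{j=1}^n\psi_j(\xi)^{-1}\Bigr)^{\left|\frac1p-\frac12\right|},\qquad |\xi|\ge C,$$ is unbounded. Then the map $\mathrm{op}:\sigma\mapsto\sigma(D)$ from $\mathcal{M}^\lambda_\psi$ to $\mathcal{L}(L^p(\mathbb{R}^n))$ is unbounded; namely, there exist a sequence $\{\sigma_k\}\subset\mathcal{M}^\lambda_\psi$ and constants $C_\alpha\ge 0$ ($\alpha$ ranging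 over all multi-indices), independent of $k$, such that $$|D^\alpha\sigma_k(\xi)|\le C_\alpha\,\lambda(\xi)\,\psi(\xi)^{-\alpha}\quad\text{for all }\xi\in\mathbb{R}^n,\ \text{all }\alpha\text{ and all }k,$$ and $$\lim_{k\to\infty}\|\sigma_k(D)\|_{\mathcal{L}(L^p(\mathbb{R}^n))}=\infty.$$
   Context: For a multi-index $\alpha=(\alpha_1,\dots,\alpha_n)$ of non-negative integers, $\psi(\xi)^{-\alpha}=\prod_{i=1}^n\psi_i(\xi)^{-\alpha_i}$, and $D^\alpha$ is the partial derivative of order $\alpha$ (up to a factor of modulus one). The symbol class $\mathcal{M}^\lambda_\psi$ is the space of all (complex-valued) $\sigma\in C^\infty(\mathbb{R}^n)$ such that for every multi-index $\alpha$ there is a constant $C_\alpha\ge0$ with $|D^\alpha\sigma(\xi)|\le C_\alpha\lambda(\xi)\psi(\xi)^{-\alpha}$ for all $\xi\in\mathbb{R}^n$. For $\sigma\in\mathcal{M}^\lambda_\psi$ (in particular $\sigma$ is bounded), $\sigma(D)$ is the operator defined on Schwartz functions $u\in\mathcal{S}(\mathbb{R}^n)$ by $[\sigma(D)u](x)=(2\pi)^{-n}\int e^{i\langle\xi,x\rangle}\sigma(\xi)\widehat{u}(\xi)\,d\xi$, with $\widehat{u}(\xi)=\int e^{-i\langle x,\xi\rangle}u(x)\,dx$. $\mathcal{L}(L^p(\mathbb{R}^n))$ is the space of bounded linear operators on $L^p(\mathbb{R}^n)$, and $\|\sigma(D)\|_{\mathcal{L}(L^p(\mathbb{R}^n))}\in[0,\infty]$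 is the supremum of $\|\sigma(D)u\|_{L^p}/\|u\|_{L^p}$ over $0\ne u\in\mathcal{S}(\mathbb{R}^n)$ (equal to $\infty$ if $\sigma(D)$ does not extend to a bounded operator on $L^p(\mathbb{R}^n)$). *)

(* Defs.v *)
From HB Require Import structures.
From mathcomp Require Import all_boot all_order all_algebra.
From mathcomp Require Import all_classical all_reals all_analysis.
From mathcomp Require Import complex.
Set Implicit Arguments.
Unset Strict Implicit.
Unset Printing Implicit Defensive.
Import Order.TTheory GRing.Theory Num.Theory numFieldNormedType.Exports.
Import ComplexField.Normc.
Local Open Scope classical_set_scope.
Local Open Scope complex_scope.
Local Open Scope ring_scope.

(* The Borel sigma-algebra of R^n, generated by the coordinate maps. *)
Definition rV_display : measure_display.
Proof. exact: default_measure_display. Qed.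

Section measurable_rV.
Context {R : realType} (n : nat).

Let coords (i : 'I_n) (x : 'rV[R]_n) : measurableTypeR R := x 0 i.

Let rV_set0 : g_sigma_preimage coords set0.
Proof. exact: sigma_algebra0. Qed.

Let rV_setC A : g_sigma_preimage coords A -> g_sigma_preimage coords (~` A).
Proof. exact: sigma_algebraC. Qed.

Let rV_bigcup (F : (set 'rV[R]_n)^nat) :
  (forall i, g_sigma_preimage coords (F i)) ->
  g_sigma_preimage coords (\bigcup_i F i).
Proof. exact: sigma_algebra_bigcup. Qed.

HB.instance Definition _ := @isMeasurable.Build rV_display
  'rV[R]_n (g_sigma_preimage coords) rV_set0 rV_setC rV_bigcup.

Lemma measurable_rV_coord (i : 'I_n) :
  measurable_fun [set: 'rV[R]_n] (fun x => x 0 i : measurableTypeR R).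
Proof.
move=> _ Y mY; rewrite setTI; apply: sub_sigma_algebra => /=.
rewrite -bigcup_seq/=; exists i => /=; first by rewrite mem_index_enum.
by exists Y => //; rewrite setTI.
Qed.

Lemma measurable_fun_rVP d (T : measurableType d) (f : T -> 'rV[R]_n) :
  measurable_fun [set: T] f <->
  forall i, measurable_fun [set: T] (fun t => f t 0 i : measurableTypeR R).
Proof.
split=> [mf i|mf].
  exact: (measurableT_comp (measurable_rV_coord i) mf).
move=> _ A mA; rewrite setTI.
suff : g_sigma_preimage coords `<=` [set A | measurable (f @^-1` A)].
  by apply.
apply: smallest_sub; first split => /=.
- by rewrite preimage_set0.
- by move=> B mB; rewrite setTD -preimage_setC; exact: measurableC.
- by move=> F mF; rewrite preimage_bigcup; exact: bigcup_measurable.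
rewrite -bigcup_seq => B [i _] [Y mY <-] /=; rewrite setTI.
by rewrite -[X in measurable X]setTI; exact: mf.
Qed.

End measurable_rV.

Section lebesgue_rV.
Context {R : realType}.

Definition rV_cons n (z : 'rV[R]_n * measurableTypeR R) : 'rV[R]_n.+1 :=
  row_mx (z.2)%:M z.1 : 'rV[R]_(1 + n).

Lemma measurable_rV_cons n : measurable_fun setT (@rV_cons n).
Proof.
apply/measurable_fun_rVP => i.
case: (splitP (i : 'I_(1 + n))) => [j|j] ij.
  have -> : (fun z => rV_cons z 0 i : measurableTypeR R) = snd.
    apply/funext => z; have -> : i = lshift n j by exact/val_inj.
    by rewrite [LHS](row_mxEl (z.2)%:M z.1) ord1 mxE eqxx mulr1n.
  exact: measurable_snd.
have -> : (fun z => rV_cons z 0 i : measurableTypeR R) =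
    (fun v : 'rV[R]_n => v 0 j : measurableTypeR R) \o fst.
  apply/funext => z; have -> : i = rshift 1 j by exact/val_inj.
  exact: (row_mxEr (z.2)%:M z.1).
exact: (measurableT_comp (measurable_rV_coord j) measurable_fst).
Qed.

(* One-step extension: m on R^n gives the product of m and the
   one-dimensional Lebesgue measure, transported to R^(n+1). *)
Definition lebesgue_rVS n (m : {measure set 'rV[R]_n -> \bar R}) :
    set 'rV[R]_n.+1 -> \bar R :=
  pushforward (m \x @lebesgue_measure R)%E (@rV_cons n).

Section lebesgue_rVS_measure.
Context (n : nat) (m : {measure set 'rV[R]_n -> \bar R}).

Let lebesgue_rVS0 : lebesgue_rVS m set0 = 0%E.
Proof. by rewrite /lebesgue_rVS measure0//; exact: measurable_rV_cons. Qed.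

Let lebesgue_rVS_ge0 A : (0 <= lebesgue_rVS m A)%E.
Proof. by apply: measure_ge0; exact: measurable_rV_cons. Qed.

Let lebesgue_rVS_sigma_additive : semi_sigma_additive (lebesgue_rVS m).
Proof.
by apply: measure_semi_sigma_additive; exact: measurable_rV_cons.
Qed.

HB.instance Definition _ := isMeasure.Build _ _ _ (lebesgue_rVS m)
  lebesgue_rVS0 lebesgue_rVS_ge0 lebesgue_rVS_sigma_additive.

End lebesgue_rVS_measure.

Fixpoint lebesgue_rV (n : nat) : {measure set 'rV[R]_n -> \bar R} :=
  match n with
  | 0 => \d_(0 : 'rV[R]_0)
  | n'.+1 => lebesgue_rVS (lebesgue_rV n')
  end.

Lemma lebesgue_rV_box n (A : 'I_n -> set (measurableTypeR R)) :
  (forall i, measurable (A i)) ->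
  lebesgue_rV n [set x | forall i, A i (x 0 i)] =
  (\prod_(i < n) lebesgue_measure (A i))%E.
Proof.
elim: n A => [A _|n IH A mA].
  by rewrite big_ord0 /= diracE mem_set//= => -[].
rewrite big_ord_recl /= /lebesgue_rVS /pushforward.
have -> : @rV_cons n @^-1` [set x | forall i, A i (x 0 i)] =
    [set v : 'rV[R]_n | forall i, A (lift ord0 i) (v 0 i)] `*` A ord0.
  apply/seteqP; split => [[v t] /= H|[v t] /= [Hv Ht] i].
    split=> [i|].
      have := H (lift ord0 i).
      have -> : lift ord0 i = rshift 1 i :> 'I_(1 + n) by exact/val_inj.
      by rewrite [rV_cons _ 0 _](row_mxEr t%:M v).
    have := H ord0.
    have -> : ord0 = lshift n ord0 :> 'I_(1 + n) by exact/val_inj.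
    by rewrite [rV_cons _ 0 _](row_mxEl t%:M v) mxE eqxx mulr1n.
  case: (unliftP ord0 i) => [j|] ->.
    have := Hv j.
    have -> : lift ord0 j = rshift 1 j :> 'I_(1 + n) by exact/val_inj.
    by rewrite [rV_cons _ 0 _](row_mxEr t%:M v).
  have := Ht.
  have -> : ord0 = lshift n ord0 :> 'I_(1 + n) by exact/val_inj.
  by rewrite [rV_cons _ 0 _](row_mxEl t%:M v) mxE eqxx mulr1n.
rewrite product_measure1E//; last first.
  have -> : [set v : 'rV[R]_n | forall i, A (lift ord0 i) (v 0 i)] =
      \bigcap_(i in [set: 'I_n]) ((fun v => v 0 i) @^-1` A (lift ord0 i)).
    by apply/seteqP; split => v /= H i; [move=> _; exact: H|exact: (H i I)].
  apply: fin_bigcap_measurable => // i _.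
  by rewrite -[X in measurable X]setTI; exact: (measurable_rV_coord i).
by rewrite muleC; congr (_ * _)%E; apply: IH => i; exact: mA.
Qed.

End lebesgue_rV.

Section fourier_multipliers.
Context {R : realType} (n : nat).
Local Notation rV := 'rV[R]_n.
Local Notation Re := (@complex.Re R).
Local Notation Im := (@complex.Im R).
Local Notation mu := (lebesgue_rV n : {measure set rV -> \bar R}).

(* On 'rV[R]_n, `|x| is the sup norm; enorm is the Euclidean norm. *)
Definition dotp (x y : rV) : R := \sum_(i < n) x 0 i * y 0 i.
Definition enorm (x : rV) : R := Num.sqrt (dotp x x).

Definition multi_index := 'I_n -> nat.

(* psi(xi)^(-alpha) *)
Definition weight (psi : 'I_n -> rV -> R) (alpha : multi_index) (xi : rV) : R :=
  \prod_(i < n) psi i xi ^- alpha i.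

Definition pderiv (i : 'I_n) (f : rV -> R) : rV -> R :=
  fun x => 'D_(delta_mx 0 i) f x.

Definition pderivs (s : seq 'I_n) (f : rV -> R) : rV -> R :=
  foldr pderiv f s.

(* C^oo: all iterated partial derivatives, in any order, exist and are
   continuous. *)
Definition smooth (f : rV -> R) : Prop :=
  forall s : seq 'I_n, continuous (pderivs s f) /\
    forall i x, derivable (pderivs s f) x (delta_mx 0 i).

(* For smooth f the order of differentiation is irrelevant. The factor of
   modulus one between D^alpha and the partial derivative is dropped: only
   moduli of derivatives are ever used. *)
Definition mderiv (alpha : multi_index) (f : rV -> R) : rV -> R :=
  pderivs (flatten [seq nseq (alpha i) i | i <- enum 'I_n]) f.

(* Complex-valued functions are differentiated and integrated through their
   real and imaginary parts. *)
Definition csmooth (f : rV -> R[i]) : Prop :=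
  smooth (Re \o f) /\ smooth (Im \o f).

Definition cmderiv (alpha : multi_index) (f : rV -> R[i]) : rV -> R[i] :=
  fun x => (mderiv alpha (Re \o f) x) +i* (mderiv alpha (Im \o f) x).

Definition cintegral (f : rV -> R[i]) : R[i] :=
  (\int[mu]_x Re (f x)) +i* (\int[mu]_x Im (f x)).

Definition expi (t : R) : R[i] := cos t +i* sin t.

Definition schwartz (u : rV -> R[i]) : Prop :=
  csmooth u /\
  forall alpha beta : multi_index, exists M : R, forall x : rV,
    normc ((\prod_(i < n) x 0 i ^+ alpha i)%:C * cmderiv beta u x) <= M.

Definition fourier (u : rV -> R[i]) (xi : rV) : R[i] :=
  cintegral (fun x => expi (- dotp x xi) * u x).

(* sigma(D) u *)
Definition multiplier (sigma : rV -> R[i]) (u : rV -> R[i]) (x : rV) : R[i] :=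
  ((2 * pi) ^- n)%:C *
  cintegral (fun xi => expi (dotp xi x) * sigma xi * fourier u xi).

Definition Lp_norm (p : R) (f : rV -> R[i]) : \bar R :=
  Lnorm mu p%:E (fun x => (normc (f x))%:E).

(* For u <> 0 in the Schwartz class, Lp_norm p u lies in ]0, +oo[, so the
   quotient is the usual one; the supremum ranges in [0, +oo]. *)
Definition op_norm (p : R) (sigma : rV -> R[i]) : \bar R :=
  ereal_sup [set (Lp_norm p (multiplier sigma u) / Lp_norm p u)%E |
    u in [set u | schwartz u /\ u <> (fun=> 0)]].

Definition symbol_class (lam : rV -> R) (psi : 'I_n -> rV -> R) :
    set (rV -> R[i]) :=
  [set sigma | csmooth sigma /\
    forall alpha : multi_index, exists2 C : R, 0 <= C &
      forall xi, normc (cmderiv alpha sigma xi) <=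
                 C * lam xi * weight psi alpha xi].

Definition Sset (psi : 'I_n -> rV -> R) (xi : rV) : set rV :=
  [set eta | forall j, psi j eta <= psi j xi].

Definition interval_rV (l : 'I_n -> R) : set rV :=
  [set eta | forall j, `|eta 0 j| <= l j].

(* Extended-real valued because mu (Sset psi xi) may a priori be infinite. *)
Definition Fp (p : R) (lam : rV -> R) (psi : 'I_n -> rV -> R) (xi : rV) :
    \bar R :=
  ((inf [set lam eta | eta in Sset psi xi])%R%:E *
   (mu (Sset psi xi) * (\prod_(j < n) (psi j xi)^-1)%R%:E)
     `^ `|p^-1 - 2^-1|%R)%E.

End fourier_multipliers.

(* Main.v *)
(* The symbols are tensor products, supported in the boxes I(xi), of symbols on
   the line. With N = 2^m, a symbol on the line is a sum of N disjoint
   bumps of fixed width, centred at the integers 0, ..., N - 1 and weighted by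
   Rudin-Shapiro signs; since the bumps are disjoint, its derivatives are bounded
   independently of N. Let T be the corresponding multiplier operator, let
   [conc] be a bump of mass 1 at scale 1/N, and let [wave] be a Rudin-Shapiro
   polynomial of length N times a fixed bump. The transform of [conc] is of
   order 1 on the lattice, that of [wave] correlates with the signs, so the
   pairing of T conc with [wave] is at least of order N. As
   |conc|_p ~ N^(1-1/p) and |wave|_p' <~ N^(1/2), Hoelder's inequality gives
   |T|_p >~ N^(1/p-1/2), which is the bound needed when p <= 2; exchanging [conc]
   and [wave] settles p > 2. The lower bound is invariant under dilations and
   multiplicative under tensor products, so lattices of step ~ c psi_j(xi)
   with N ~ l_j(xi) / (c psi_j(xi)) points in the j-th variable, and the factor
   inf lambda over S(xi), give operators of norm at least a constant times
   F_p(xi). *)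

From HB Require Import structures.
Require Import Defs.
From mathcomp Require Import all_boot all_order all_algebra.
From mathcomp Require Import all_classical all_reals all_analysis.
From mathcomp Require Import measurable_realfun complex ring lra.
Set Implicit Arguments.
Unset Strict Implicit.
Unset Printing Implicit Defensive.
Import Order.TTheory GRing.Theory Num.Theory numFieldNormedType.Exports.
Import ComplexField.Normc.
Local Open Scope classical_set_scope.
Local Open Scope ring_scope.

(** * Smooth functions on the line *)

Section smooth_functions.
Context {R : realType}.
Local Open Scope classical_set_scope.
Implicit Types (f g h : R -> R) (P : {poly R}).

(** The estimate on the line uses real functions only. The Rudin-Shapiro pair P, Q gives four real
    sums, the cosine and sine parts of each; the parallelogram identity controls only the total of
    their squares, so for every m one of the four is selected whose mean square against a bump is at
    least N/2. Since [conc] is even it has no sine transform, and the pairing is read off the real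
    or the imaginary part of the output according to this selection.

    The obstacle is that the bumps of the symbol have fixed width: neither transform may change much
    between a lattice point and the edge of its bump. That of [conc] has Lipschitz constant 1/N and
    is corrected exactly at the lattice points; that of [wave] is perturbed by a phase theta y with
    |y| at most 1. The radius 1/16 keeps both losses below the main term.

    In dimension n the set S(xi) acts twice. On it lambda is at least its infimum and psi_j at most
    psi_j(xi), so a symbol living in I(xi), of height this infimum and lattice step c psi_j(xi),
    satisfies the symbol estimates with constants depending on alpha and c alone. And the bound on
    mu(S(xi)) by mu(I(xi)) makes the numbers of lattice points account for F_p(xi). *)

Definition smooth1 h := forall n x, derivable h^`(n) x 1.

(** Differentiability up to order n, peeling off the innermost derivative: the product rule then
    proves [CkM] by induction on n, whereas [smooth1] speaks of the outermost derivative. *)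
Fixpoint Ck n h : Prop :=
  if n is m.+1 then (forall x, derivable h x 1) /\ Ck m h^`() else True.

Lemma CkW n h : Ck n.+1 h -> Ck n h.
Proof.
elim: n h => [|n IH] h; first by [].
by move=> [dh Hh]; split; [|exact: IH].
Qed.

Lemma smooth1P h : smooth1 h <-> forall n, Ck n h.
Proof.
split=> [sh n|Ch n x].
  elim: n h sh => [|n IH] h sh; first by [].
  by split=> [x|]; [exact: (sh 0)|apply: IH => k x; rewrite -derive1Sn; exact: sh].
elim: n h Ch x => [|n IH] h Ch x; first by have [] := Ch 1%N.
by rewrite derive1Sn; apply: IH => k; have [] := Ch k.+1.
Qed.

Lemma CkD n f g : Ck n f -> Ck n g -> Ck n (f \+ g).
Proof.
elim: n f g => [|n IH] f g; first by [].
move=> [df cf] [dg cg]; split=> [x|]; first exact: derivableD.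
have -> : (f \+ g)^`() = f^`() \+ g^`().
  by apply/funext => x; rewrite /= !derive1E; exact: deriveD.
exact: IH.
Qed.

Lemma CkM n f g : Ck n f -> Ck n g -> Ck n (f \* g).
Proof.
elim: n f g => [|n IH] f g; first by [].
move=> Hf Hg; have [df cf] := Hf; have [dg cg] := Hg; split=> [x|]; first exact: derivableM.
have -> : (f \* g)^`() = (f \* g^`()) \+ (g \* f^`()).
  by apply/funext => x; rewrite /= !derive1E; exact: deriveM.
by apply: CkD; apply: IH => //; exact: CkW.
Qed.

Lemma smooth1D f g : smooth1 f -> smooth1 g -> smooth1 (f \+ g).
Proof.
by move=> /smooth1P sf /smooth1P sg; apply/smooth1P => n; exact: CkD.
Qed.

Lemma smooth1M f g : smooth1 f -> smooth1 g -> smooth1 (f \* g).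
Proof.
by move=> /smooth1P sf /smooth1P sg; apply/smooth1P => n; exact: CkM.
Qed.

Lemma smooth1_derive f : smooth1 f -> smooth1 f^`().
Proof. by move=> sf n x; rewrite -derive1Sn; exact: sf. Qed.

(** Smoothness by invariance: to treat a given function, exhibit a family that contains it and is
    stable under derivation. *)
Lemma smooth1_closed (A : set (R -> R)) :
  (forall f, A f -> (forall x, derivable f x 1) /\ A f^`()) ->
  forall f, A f -> smooth1 f.
Proof.
move=> HA f Af n x; suff /HA[+ _] : A f^`(n) by apply.
by elim: n => [//|n /HA[_]]; rewrite derive1nS.
Qed.

Lemma smooth1_cst c : smooth1 (cst c).
Proof.
apply: (@smooth1_closed [set f | exists c, f = cst c]); last by exists c.
move=> _ [d ->]; split=> [x|]; first exact: derivable_cst.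
by exists 0; apply/funext => x; rewrite derive1_cst.
Qed.

Lemma smooth1_sum (I : Type) (r : seq I) (F : I -> R -> R) :
  (forall i, smooth1 (F i)) -> smooth1 (fun x => \sum_(i <- r) F i x).
Proof.
move=> sF; elim: r => [|i r IH].
  rewrite (_ : (fun x => _) = cst 0); first exact: smooth1_cst.
  by apply/funext => x; rewrite big_nil.
rewrite (_ : (fun x => _) = F i \+ (fun x => \sum_(i <- r) F i x)).
  exact: (smooth1D (sF i) IH).
by apply/funext => x; rewrite big_cons.
Qed.

Let is_derive_affine (a b x : R) : is_derive x 1 (fun t : R => a * t + b) a.
Proof.
have -> : (fun t : R => a * t + b) = (a *: id) \+ cst b by [].
have H := is_deriveD (is_deriveZ a (is_derive_id x 1)) (is_derive_cst b x 1).
apply: (is_derive_eq H); by rewrite addr0 /GRing.scale /= mulr1.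
Qed.

Lemma derive1_affine f a b : (forall x, derivable f x 1) ->
  (fun x => f (a * x + b))^`() = (fun x => a * derive1 f (a * x + b)).
Proof.
move=> df; apply/funext => x.
have H := is_derive_affine a b x.
rewrite [LHS](derive1_comp (@ex_derive _ _ _ _ _ _ _ H) (df _)).
by rewrite mulrC [X in X * _]derive1E derive_val.
Qed.

Lemma smooth1_affine f a b : smooth1 f -> smooth1 (fun x => f (a * x + b)).
Proof.
move=> sf; apply: (@smooth1_closed
  [set g | exists c f, smooth1 f /\ g = fun x => c * f (a * x + b)]); last first.
  by exists 1, f; split=> //; apply/funext => x; rewrite mul1r.
move=> _ [c [g [sg ->]]].
have dg x : derivable (fun x => g (a * x + b)) x 1.
  have H := is_derive_affine a b x.
  apply/derivable1_diffP; apply: (@differentiable_comp _ _ _ _ (fun x => a * x + b) g).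
    exact/derivable1_diffP.
  by apply/derivable1_diffP; exact: (sg 0).
split=> [x|]; first exact: (@derivableZ _ _ _ (fun x => g (a * x + b)) c x 1).
exists (c * a), g^`(); split; first exact: smooth1_derive.
apply/funext => x; rewrite derive1E [LHS](@deriveZ _ _ _ (fun x => g (a * x + b)) c _ _ (dg x)).
rewrite -derive1E derive1_affine; last exact: (sg 0).
by rewrite -[LHS]/(c * (a * _)) mulrA.
Qed.

Lemma derive1n_affine f a b n : smooth1 f ->
  (fun x => f (a * x + b))^`(n) = (fun x => a ^+ n * derive1n n f (a * x + b)).
Proof.
move=> sf; elim: n => [|n IH].
  by apply/funext => x; rewrite !derive1n0 expr0 mul1r.
rewrite derive1nS IH; apply/funext => x.
have sg := smooth1_affine (a := a) (b := b) (f := derive1n n f).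
rewrite derive1E [LHS](@deriveZ _ _ _ (fun x => derive1n n f (a * x + b)) (a ^+ n));
  last first.
  by apply: (sg _ 0) => k y; rewrite /derive1n -iterD; exact: sf.
rewrite -derive1E derive1_affine; last exact: sf.
by rewrite -[LHS]/(a ^+ n * (a * _)) mulrA -exprSr derive1nS.
Qed.

Lemma smooth1_continuous f : smooth1 f -> continuous f.
Proof. by move=> sf x; apply: differentiable_continuous; apply/derivable1_diffP;
  exact: (sf 0). Qed.

Lemma smooth1_deriven f n : smooth1 f -> smooth1 f^`(n).
Proof. by move=> sf k x; rewrite /derive1n -iterD; exact: sf. Qed.

Lemma derive1nD f g n : smooth1 f -> smooth1 g ->
  (f \+ g)^`(n) = f^`(n) \+ g^`(n).
Proof.
move=> sf sg; elim: n => [//|n IH]; rewrite derive1nS IH; apply/funext => x.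
rewrite -[RHS]/(derive1n n.+1 f x + derive1n n.+1 g x) !derive1nS !derive1E.
exact: (deriveD (sf n x) (sg n x)).
Qed.

Lemma derive1nZ f c n : smooth1 f ->
  (fun x => c * f x)^`(n) = (fun x => c * derive1n n f x).
Proof.
move=> sf; elim: n => [//|n IH]; rewrite derive1nS IH; apply/funext => x.
rewrite !derive1nS derive1E [LHS](@deriveZ _ _ _ (derive1n n f) c); last exact: sf.
by rewrite !derive1E.
Qed.

Lemma derive1n_sum (I : Type) (r : seq I) (F : I -> R -> R) n :
  (forall i, smooth1 (F i)) ->
  (fun x => \sum_(i <- r) F i x)^`(n) = (fun x => \sum_(i <- r) derive1n n (F i) x).
Proof.
move=> sF; elim: r => [|i r IH].
  have -> : (fun x => \sum_(i <- [::]) F i x) = cst 0.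
    by apply/funext => x; rewrite big_nil.
  apply/funext => x; rewrite big_nil; elim: n x => [//|n IH] x.
  by rewrite derive1Sn; have -> : (cst 0)^`() = cst 0 :> (R -> R)
    by apply/funext => y; rewrite derive1_cst.
have -> : (fun x => \sum_(i <- i :: r) F i x) =
    F i \+ (fun x => \sum_(i <- r) F i x).
  by apply/funext => x; rewrite big_cons.
rewrite derive1nD // ?IH; last exact: smooth1_sum.
by apply/funext => x /=; rewrite big_cons.
Qed.

Lemma derive1n_support f (a b : R) n : (forall x, x < a \/ b < x -> f x = 0) ->
  forall x, x < a \/ b < x -> f^`(n) x = 0.
Proof.
move=> f0; elim: n => [//|n IH] x xab; rewrite derive1nS derive1E.
rewrite (@near_eq_derive _ _ _ _ (cst 0)) ?derive_cst //.
case: xab => [xa|xb].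
  by near=> y; apply: IH; left; near: y; exact: lt_nbhsl.
by near=> y; apply: IH; right; near: y; exact: lt_nbhsr.
Unshelve. all: by end_near.
Qed.

End smooth_functions.

(** * A smooth bump function *)

Section bump.
Context {R : realType}.
Local Open Scope classical_set_scope.
Implicit Types (P : {poly R}) (x y : R).

Lemma exprn_le_expR n y : 0 <= y -> y ^+ n <= n%:R ^+ n * expR y.
Proof.
case: n => [|n] y0; first by rewrite !expr0 mul1r -[X in X <= _]expR0 ler_expR.
have -> : expR y = expR (y / n.+1%:R) ^+ n.+1.
  by rewrite -expRM_natr divfK// pnatr_eq0.
rewrite -exprMn lerXn2r ?nnegrE ?mulr_ge0 ?expR_ge0//.
apply: le_trans (_ : n.+1%:R * (y / n.+1%:R) <= _).
  by rewrite mulrC divfK// pnatr_eq0.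
rewrite ler_wpM2l//; apply: le_trans (expR_ge1Dx _).
by rewrite lerDr.
Qed.

(** With y = 1/h the decay in y^-2 bounds [flat P h] by K h^2, which sends the difference quotient
    of [flat P] at 0 to 0. *)
Lemma poly_expRN_bounded P :
  exists2 K, 0 <= K & forall y, 0 < y -> `|P.[y] * expR (- y)| <= K * y ^- 2.
Proof.
exists (\sum_(i < size P) `|P`_i| * i.+2%:R ^+ i.+2).
  by apply: sumr_ge0 => i _; rewrite mulr_ge0// exprn_ge0.
move=> y y0; rewrite normrM (ger0_norm (expR_ge0 _)) expRN.
rewrite ler_pdivrMr ?expR_gt0// mulrAC ler_pdivlMr ?exprn_gt0//.
rewrite horner_coef mulr_suml; apply: le_trans (_ : (\sum_(i < size P) `|P`_i * y ^+ i|) * y ^+ 2 <= _).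
  by rewrite ler_pM2r ?exprn_gt0// ler_norm_sum.
rewrite mulr_suml ler_sum// => i _.
rewrite normrM (ger0_norm (exprn_ge0 _ (ltW y0))) -[leLHS]mulrA -[leRHS]mulrA.
by apply: ler_wpM2l => //; rewrite -exprD addn2; apply: exprn_le_expR; exact: ltW.
Qed.

(* The functions [P(1/x) exp(-1/x)], extended by 0 to [x <= 0]: allowing all
   polynomials [P] makes the family stable under derivation. *)
Definition flat P x : R := if 0 < x then P.[x^-1] * expR (- x^-1) else 0.

Lemma is_derive_flat P x : is_derive x 1 (flat P) (flat ('X^2 * (P - P^`())) x).
Proof.
have [x0|x0|<-] := ltgtP 0 x.
- apply: (@near_eq_is_derive _ _ _ (fun x => P.[x^-1] * expR (- x^-1))).
    by near=> y; rewrite /flat ifT//; near: y; exact: lt_nbhsr.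
  have Hi := is_deriveV (lt0r_neq0 x0) (is_derive_id x 1).
  have Hp := is_derive1_comp (is_derive_poly P x^-1) Hi.
  have He := @is_derive1_comp _ expR (fun y => - y^-1) x _ _ (is_derive_expR _) (is_deriveN Hi).
  apply: (is_derive_eq (is_deriveM Hp He)).
  rewrite /flat x0 !hornerE /GRing.scale /= exprVn !mulr1.
  set a := P.[_]; set b := expR _; set c := (x ^+ 2)^-1; set d := (_^`()).[_].
  by rewrite -[LHS]/((a * (b * (- - c)) + b * (d * - c))%R : R); ring.
- rewrite /flat [X in is_derive _ _ _ X]ifF; last by apply/negbTE; rewrite -leNgt ltW.
  apply: (@near_eq_is_derive _ _ _ (cst (0 : R))).
  near=> y; rewrite /flat ifF//; apply/negbTE; rewrite -leNgt ltW//.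
  by near: y; exact: lt_nbhsl.
rewrite /flat [X in is_derive _ _ _ X]ifF ?ltxx//.
have [K K0 HK] := poly_expRN_bounded P.
suff H : (fun h : R => h^-1 *: (flat P (h *: 1 + 0) - flat P 0)) @ 0^' --> 0.
  split; first by apply/cvg_ex; exists 0; exact: H.
  by apply/cvg_lim => //; exact: H.
apply/cvgr0Pnorm_lt => e e0.
have K1 : 0 < K + 1 by lra.
have eK : 0 < e / (K + 1) by rewrite divr_gt0.
near=> h.
have h0 : h != 0 by near: h; exact: nbhs_dnbhs_neq.
rewrite /flat ltxx subr0 addr0 [h *: 1]mulr1 -[h^-1 *: _]/(h^-1 * _).
case: ifPn => hp; last by rewrite mulr0 normr0.
have := HK h^-1; rewrite invr_gt0 => /(_ hp) Hh.
rewrite normrM normfV (gtr0_norm hp) mulrC ltr_pdivrMr//.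
apply: le_lt_trans Hh _; rewrite -exprVn invrK expr2 mulrA ltr_pM2r//.
apply: le_lt_trans (_ : (K + 1) * h < _); first by rewrite ler_wpM2r ?ltW//; lra.
rewrite mulrC -ltr_pdivlMr//; apply: le_lt_trans (ler_norm _) _.
by near: h; exact: (dnbhs0_lt eK).
Unshelve. all: by end_near.
Qed.

Lemma smooth1_flat P : smooth1 (flat P).
Proof.
apply: (@smooth1_closed _ (range flat)); last by exists P.
move=> _ [Q _ <-]; split=> [x|]; first exact: (@ex_derive _ _ _ _ _ _ _ (is_derive_flat Q x)).
exists ('X^2 * (Q - Q^`()))%R => //; apply/funext => x.
by rewrite derive1E; apply/esym; exact: (@derive_val _ _ _ _ _ _ _ (is_derive_flat Q x)).
Qed.

Lemma flat1_ge0 x : 0 <= flat 1 x.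
Proof. by rewrite /flat; case: ifP => // _; rewrite hornerC mul1r expR_ge0. Qed.

Lemma flat1_gt0 x : (0 < flat 1 x) = (0 < x).
Proof. by rewrite /flat; case: ifP => _; rewrite ?ltxx// hornerC mul1r expR_gt0. Qed.

(** One cutoff at each of the points -1 and 1; the slopes are explicit to match [smooth1_affine]. *)
Definition bump0 x := flat 1 (1 * x + 1) * flat 1 (-1 * x + 1).

Lemma smooth1_bump0 : smooth1 bump0.
Proof. by apply: smooth1M; apply: smooth1_affine; exact: smooth1_flat. Qed.

Lemma bump0N x : bump0 (- x) = bump0 x.
Proof. by rewrite /bump0 mulrC; congr (flat 1 _ * flat 1 _); ring. Qed.

Lemma bump0_ge0 x : 0 <= bump0 x.
Proof. by rewrite mulr_ge0// flat1_ge0. Qed.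

Lemma bump0_gt0 x : (0 < bump0 x) = (`|x| < 1).
Proof.
rewrite ltr_norml /bump0; apply/idP/andP => [|[h1 h2]]; last first.
  by rewrite mulr_gt0// flat1_gt0; lra.
move=> h; have : 0 < flat 1 (1 * x + 1) /\ 0 < flat 1 (-1 * x + 1).
  move: h (flat1_ge0 (1 * x + 1)) (flat1_ge0 (-1 * x + 1)); rewrite !le_eqVlt.
  by move=> h /orP[/eqP h1|->] /orP[/eqP h2|->] //; move: h;
    rewrite -?h1 -?h2 ?mulr0 ?mul0r ltxx.
by rewrite !flat1_gt0 => -[]; split; lra.
Qed.

End bump.

(** * Cosine and sine transforms *)

Section integrals.
Context {R : realType}.
Local Open Scope classical_set_scope.
Local Notation mu := (@lebesgue_measure R).
Implicit Types (f g h u v : R -> R) (x y a b : R).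

(** A class on which every integral below converges. It is stable under multiplication by bounded
    measurable functions, hence by the trigonometric kernels and by transforms of other members. *)
Definition bndsupp h := measurable_fun setT h /\
  exists a M : R, forall x, `|h x| <= M /\ (a < `|x| -> h x = 0).

Lemma bndsuppP h (a M : R) : measurable_fun setT h -> (forall x, `|h x| <= M) ->
  (forall x, a < `|x| -> h x = 0) -> bndsupp h.
Proof. by move=> mh hM h0; split=> //; exists a, M => x; split=> //; exact: h0. Qed.

Lemma bndsupp_measurable h : bndsupp h -> measurable_fun setT h.
Proof. by case. Qed.

Lemma bndsupp_bound h : bndsupp h -> exists a M : R, [/\ 0 <= a, 0 <= M,
  forall x, `|h x| <= M & forall x, a < `|x| -> h x = 0].
Proof.
case=> _ [a [M H]]; exists (Num.max a 0), M; split.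
- by rewrite le_max lexx orbT.
- exact: le_trans (normr_ge0 _) (H 0).1.
- by move=> x; have [] := H x.
- by move=> x; rewrite gt_max => /andP[ax _]; apply (H x).2.
Qed.

Lemma bndsupp_integrable h : bndsupp h -> mu.-integrable setT (EFin \o h).
Proof.
move=> hn; have [mh _] := hn; have [a [M [a0 M0 hM h0]]] := bndsupp_bound hn.
pose A : set R := `[- a, a].
have mab : measurable A by exact: measurable_itv.
apply/integrableP; split; first exact/measurable_EFinP.
have H : (\int[mu]_x `|(EFin \o h) x| <= \int[mu]_(x in A) M%:E)%E.
  rewrite [leRHS]integral_mkcond; apply: ge0_le_integral => //.
  - by apply: measurableT_comp => //; exact/measurable_EFinP.
  - by apply/(measurable_restrictT _ mab); exact: measurable_cst.
  move=> x _; rewrite patchE; case: ifPn => [_|xa]; first by rewrite /= lee_fin.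
  rewrite /= h0 ?normr0// ltNge; apply: contra xa => xa.
  by apply/mem_set; rewrite /A/= in_itv/= -ler_norml.
apply: (le_lt_trans H); rewrite /A.
rewrite integral_cst//= lebesgue_measure_itv/=; case: ifP => _.
  by rewrite -EFinB -EFinM ltry.
by rewrite mule0 ltry.
Qed.

Lemma bndsuppM h g (K : R) : bndsupp h -> measurable_fun setT g ->
  (forall x, `|g x| <= K) -> bndsupp (fun x => g x * h x).
Proof.
move=> hn mg gK; have [mh _] := hn; have [a [M [a0 M0 hM h0]]] := bndsupp_bound hn.
apply: (@bndsuppP _ a (K * M)); first exact: measurable_funM.
  by move=> x; rewrite normrM ler_pM.
by move=> x xa; rewrite h0// mulr0.
Qed.

Lemma bndsuppD f h : bndsupp f -> bndsupp h -> bndsupp (fun x => f x + h x).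
Proof.
move=> fn hn; have [a [M [_ _ fM f0]]] := bndsupp_bound fn.
have [a' [M' [_ _ hM h0]]] := bndsupp_bound hn.
apply: (@bndsuppP _ (Num.max a a') (M + M')).
- by apply: measurable_funD; exact: bndsupp_measurable.
- by move=> x; rewrite (le_trans (ler_normD _ _))// lerD.
- by move=> x; rewrite gt_max => /andP[? ?]; rewrite f0// h0// addr0.
Qed.

Lemma bndsuppZ c h : bndsupp h -> bndsupp (fun x => c * h x).
Proof. by move=> hn; exact: (@bndsuppM _ (cst c) `|c|). Qed.

Lemma bndsupp_sum (I : Type) (r : seq I) (F : I -> R -> R) :
  (forall i, bndsupp (F i)) -> bndsupp (fun x => \sum_(i <- r) F i x).
Proof.
move=> nF; elim: r => [|i r IH].
  rewrite (_ : (fun x => _) = cst 0); last by apply/funext => x; rewrite big_nil.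
  by apply: (@bndsuppP _ 0 0) => // x; rewrite normr0.
rewrite (_ : (fun x => _) = (fun x => F i x + \sum_(i <- r) F i x)).
  exact: bndsuppD.
by apply/funext => x; rewrite big_cons.
Qed.

Lemma bndsupp_norm h : bndsupp h -> bndsupp (fun x => `|h x|).
Proof.
move=> hn; have [a [M [_ _ hM h0]]] := bndsupp_bound hn.
apply: (@bndsuppP _ a M) => [|x|x xa]; first by apply: measurableT_comp => //;
  exact: bndsupp_measurable.
  by rewrite normr_id.
by rewrite h0// normr0.
Qed.

Lemma bndsupp_id h : bndsupp h -> bndsupp (fun x => x * h x).
Proof.
move=> hn; have [a [M [a0 M0 hM h0]]] := bndsupp_bound hn.
apply: (@bndsuppP _ a (a * M)).
- by apply: measurable_funM => //; exact: bndsupp_measurable.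
- move=> x; rewrite normrM; have [xa|xa] := leP `|x| a; first by rewrite ler_pM.
  by rewrite h0// normr0 mulr0 mulr_ge0.
- by move=> x xa; rewrite h0// mulr0.
Qed.

Lemma continuous_bounded_itv h a : continuous h ->
  exists M : R, forall x, `|x| <= a -> `|h x| <= M.
Proof.
move=> ch; have [a0|a0] := leP 0 a; last first.
  by exists 0 => x xa; have := le_trans (normr_ge0 x) xa; rewrite leNgt a0.
have [||c _ Hc] := @EVT_max R (fun x => `|h x|) (- a) a; first by lra.
  apply: continuous_subspaceT => x.
  by apply: continuous_comp; [exact: ch|exact: norm_continuous].
by exists `|h c| => x xa; apply: Hc; rewrite in_itv/= -ler_norml.
Qed.

Lemma bndsupp_continuous h a : continuous h -> (forall x, a < `|x| -> h x = 0) ->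
  bndsupp h.
Proof.
move=> ch h0; have [M HM] := continuous_bounded_itv a ch.
apply: (@bndsuppP _ a (Num.max M 0)) => //; first exact: continuous_measurable_fun.
move=> x; rewrite le_max; have [xa|xa] := leP `|x| a; first by rewrite HM.
by rewrite h0// normr0 lexx orbT.
Qed.

Lemma bndsupp_RintegralD f h : bndsupp f -> bndsupp h ->
  \int[mu]_x (f x + h x) = \int[mu]_x f x + \int[mu]_x h x.
Proof. by move=> fn hn; apply: RintegralD => //; exact: bndsupp_integrable. Qed.

Lemma bndsupp_RintegralZ c h : bndsupp h ->
  \int[mu]_x (c * h x) = c * \int[mu]_x h x.
Proof. by move=> hn; apply: RintegralZl => //; exact: bndsupp_integrable. Qed.

Lemma bndsupp_Rintegral_sum (I : Type) (r : seq I) (F : I -> R -> R) :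
  (forall i, bndsupp (F i)) ->
  \int[mu]_x (\sum_(i <- r) F i x) = \sum_(i <- r) \int[mu]_x F i x.
Proof.
move=> nF; elim: r => [|i r IH].
  rewrite big_nil; under eq_Rintegral do rewrite big_nil.
  by rewrite Rintegral_cst// mul0r.
rewrite big_cons -IH -bndsupp_RintegralD//; last exact: bndsupp_sum.
by apply: eq_Rintegral => x _; rewrite big_cons.
Qed.

Lemma bndsupp_le_Rintegral f h : bndsupp f -> bndsupp h -> (forall x, f x <= h x) ->
  \int[mu]_x f x <= \int[mu]_x h x.
Proof. by move=> fn hn fh; apply: le_Rintegral => //; exact: bndsupp_integrable. Qed.

Lemma bndsupp_normr_Rintegral h : bndsupp h ->
  `|\int[mu]_x h x| <= \int[mu]_x `|h x|.
Proof. by move=> hn; apply: le_normr_Rintegral => //; exact: bndsupp_integrable. Qed.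

(* The kernels cos and sin of the real and imaginary parts of the Fourier
   transform are treated uniformly. *)
Definition trig (t : bool) y : R := if t then cos y else sin y.

Lemma continuous_trig t : continuous (trig t).
Proof. by case: t => x; [exact: continuous_cos|exact: continuous_sin]. Qed.

Lemma measurable_trig t : measurable_fun setT (trig t).
Proof. by apply: continuous_measurable_fun; exact: continuous_trig. Qed.

Lemma trig_le1 t y : `|trig t y| <= 1.
Proof. by rewrite ler_norml; case: t; rewrite ?cos_geN1 ?cos_le1 ?sin_geN1 ?sin_le1. Qed.

Lemma trig_lip t x y : `|trig t x - trig t y| <= `|x - y|.
Proof.
wlog xy : x y / x <= y => [H|].
  by have [/H//|/ltW/H] := leP x y; rewrite distrC (distrC y).
pose d y : R := if t then - sin y else cos y.
have [||c _ H] := @MVT_segment R (trig t) d x y xy.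
- by move=> z _; rewrite /d /trig; case: (t); [exact: is_derive_cos|exact: is_derive_sin].
- by apply: continuous_subspaceT; exact: continuous_trig.
rewrite distrC H normrM (distrC x) ler_piMl//.
by rewrite /d; case: (t); rewrite ?normrN ?(trig_le1 false)// (trig_le1 true).
Qed.

Definition ftrig t h x := \int[mu]_y (trig t (x * y) * h y).

Lemma bndsupp_trigM t x h : bndsupp h -> bndsupp (fun y => trig t (x * y) * h y).
Proof.
move=> hn; apply: (@bndsuppM _ _ 1) => //; last by move=> y; exact: trig_le1.
apply: measurableT_comp (@measurable_trig t) _; exact: measurable_funM.
Qed.

Lemma ftrig_bounded t h x : bndsupp h -> `|ftrig t h x| <= \int[mu]_y `|h y|.
Proof.
move=> hn; apply: le_trans (bndsupp_normr_Rintegral (bndsupp_trigM t x hn)) _.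
apply: bndsupp_le_Rintegral; [exact/bndsupp_norm/bndsupp_trigM|exact: bndsupp_norm|].
by move=> y; rewrite normrM ler_piMl// trig_le1.
Qed.

Lemma ftrig_lip t h x x' : bndsupp h ->
  `|ftrig t h x - ftrig t h x'| <= `|x - x'| * \int[mu]_y `|y * h y|.
Proof.
move=> hn; have nn := bndsupp_trigM.
have -> : ftrig t h x - ftrig t h x' = \int[mu]_y ((trig t (x * y) - trig t (x' * y)) * h y).
  have -> : - ftrig t h x' = -1 * ftrig t h x' by rewrite mulN1r.
  rewrite -bndsupp_RintegralZ; last exact: nn.
  rewrite -bndsupp_RintegralD; [|exact: nn|exact/bndsuppZ/nn].
  by apply: eq_Rintegral => y _; ring.
have nd : bndsupp (fun y => (trig t (x * y) - trig t (x' * y)) * h y).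
  have -> : (fun y => (trig t (x * y) - trig t (x' * y)) * h y) =
      (fun y => trig t (x * y) * h y + -1 * (trig t (x' * y) * h y)).
    by apply/funext => y; ring.
  by apply: bndsuppD; [exact: nn|exact/bndsuppZ/nn].
apply: le_trans (bndsupp_normr_Rintegral nd) _.
rewrite -bndsupp_RintegralZ; last exact/bndsupp_norm/bndsupp_id.
apply: bndsupp_le_Rintegral; [exact: bndsupp_norm|exact/bndsuppZ/bndsupp_norm/bndsupp_id|].
move=> y; rewrite !normrM mulrA ler_wpM2r// (le_trans (trig_lip _ _ _))//.
by rewrite -mulrBl normrM.
Qed.

Lemma continuous_ftrig t h : bndsupp h -> continuous (ftrig t h).
Proof.
move=> hn x; set L := \int[mu]_y `|y * h y|.
have L0 : 0 <= L by apply: Rintegral_ge0.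
apply/cvgrPdist_le => e e0.
have eL : 0 < e / (L + 1) by rewrite divr_gt0// ltr_wpDl.
near=> z; apply: le_trans (ftrig_lip t x z hn) _.
apply: (@le_trans _ _ (e / (L + 1) * (L + 1))); last by rewrite divfK// gt_eqF// ltr_wpDl.
apply: ler_pM; [exact: normr_ge0|exact: L0| |by rewrite lerDl].
near: z; apply: cvgr_dist_le; first exact: cvg_id.
exact: eL.
Unshelve. all: by end_near.
Qed.

Lemma measurable_ftrig t h : bndsupp h -> measurable_fun setT (ftrig t h).
Proof. by move=> hn; apply: continuous_measurable_fun; exact: continuous_ftrig. Qed.

End integrals.

(** * Change of variables and the duality of the transforms *)

Section change_of_variables.
Context {R : realType}.
Local Open Scope classical_set_scope.
Local Notation mR := (measurableTypeR R).
Local Notation mu := (@lebesgue_measure R).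

Section transport.
Variables (phi : mR -> mR) (k : R).
Hypotheses (mphi : measurable_fun setT phi) (k0 : 0 <= k).
Hypothesis phiE : forall A : set mR, measurable A ->
  mu (phi @^-1` A) = (k%:E * mu A)%E.

(** By [phiE] the image of Lebesgue measure under [phi] is [k] times Lebesgue measure; this covers
    affine maps and the reflection at once. *)
Lemma ge0_integral_transport (f : mR -> \bar R) :
  measurable_fun setT f -> (forall x, (0 <= f x)%E) ->
  (\int[mu]_x f (phi x) = k%:E * \int[mu]_x f x)%E.
Proof.
move=> mf f0.
rewrite -[LHS](@ge0_integral_pushforward _ _ _ _ _ _ mphi mu setT f)//.
rewrite (eq_measure_integral (mscale (NngNum k0) mu)).
  by rewrite ge0_integral_mscale.
by move=> A mA _; rewrite /= /pushforward phiE.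
Qed.

Lemma Rintegral_transport (f : mR -> R) : mu.-integrable setT (EFin \o f) ->
  \int[mu]_x f (phi x) = k * \int[mu]_x f x.
Proof.
move=> fi; have mf := measurable_int mu fi.
rewrite /Rintegral -[RHS]/(fine k%:E * _) -fineM//; last exact: integrable_fin_num.
congr fine.
have Hp : (\int[mu]_x (EFin \o f \o phi)^\+ x)%E = (k%:E * \int[mu]_x (EFin \o f)^\+ x)%E.
  rewrite -ge0_integral_transport//; last exact: measurable_funepos.
  by apply: eq_integral => x _; rewrite funepos_comp.
have Hn : (\int[mu]_x (EFin \o f \o phi)^\- x)%E = (k%:E * \int[mu]_x (EFin \o f)^\- x)%E.
  rewrite -ge0_integral_transport//; last exact: measurable_funeneg.
  by apply: eq_integral => x _; rewrite funeneg_comp.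
have -> : (\int[mu]_x (f (phi x))%:E)%E =
    (k%:E * \int[mu]_x (EFin \o f)^\+ x - k%:E * \int[mu]_x (EFin \o f)^\- x)%E.
  by rewrite integralE -Hp -Hn.
rewrite -muleBr//; last first.
  apply: fin_num_adde_defr; apply: integrable_fin_num => //.
  exact: integrable_funepos.
by rewrite [in RHS]integralE.
Qed.

End transport.

(** The image measure multiplied by [a] gives half-open intervals their length, so it is Lebesgue
    measure by uniqueness. *)
Lemma lebesgue_measure_affine (a b : R) (A : set mR) : 0 < a -> measurable A ->
  mu ((fun x : mR => a * x + b : mR) @^-1` A) = ((a^-1)%:E * mu A)%E.
Proof.
move=> a0 mA; pose phi : mR -> mR := fun x => a * x + b.
have mphi : measurable_fun setT phi.
  by apply: measurable_funD => //; exact: measurable_funM.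
pose phi' : {mfun mR >-> mR} := HB.pack phi (isMeasurableFun.Build _ _ _ _ _ mphi).
have a0' := ltW a0.
rewrite [in RHS](@lebesgue_measure_unique R (mscale (NngNum a0') (pushforward mu phi')))//.
  rewrite /= /mscale /pushforward /= muleA -EFinM mulVf ?mul1e//.
  exact: lt0r_neq0.
move=> _ [[c d] _ <-] /=; rewrite /mscale /= /pushforward.
have -> : phi @^-1` `]c, d] = `]((c - b) / a), ((d - b) / a)]%classic.
  apply/seteqP; split=> x /=; rewrite !in_itv/= /phi ltr_pdivrMr// ler_pdivlMr//;
  by move=> /andP[h1 h2]; apply/andP; split; lra.
rewrite !lebesgue_measure_itv/= !lte_fin ltr_pM2r ?invr_gt0// ltrD2r.
case: ifP => _; last by rewrite mule0.
rewrite -!EFinB -EFinM; congr EFin; field; exact: lt0r_neq0.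
Qed.

Lemma measurable_affine (a b : R) : measurable_fun setT (fun x : mR => a * x + b : mR).
Proof. by apply: measurable_funD => //; exact: measurable_funM. Qed.

Lemma ge0_integral_affine (a b : R) (f : mR -> \bar R) : 0 < a ->
  measurable_fun setT f -> (forall x, (0 <= f x)%E) ->
  (\int[mu]_x f (a * x + b)%R = (a^-1)%:E * \int[mu]_x f x)%E.
Proof.
move=> a0 mf f0.
apply: (ge0_integral_transport (measurable_affine a b)) => //.
  by rewrite invr_ge0 ltW.
by move=> A mA; exact: lebesgue_measure_affine.
Qed.

Lemma Rintegral_affine (a b : R) (f : R -> R) : 0 < a -> bndsupp f ->
  \int[mu]_x f (a * x + b) = a^-1 * \int[mu]_x f x.
Proof.
move=> a0 fn; apply: (Rintegral_transport (measurable_affine a b)).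
- by rewrite invr_ge0 ltW.
- by move=> A mA; exact: lebesgue_measure_affine.
- exact: bndsupp_integrable.
Qed.

Lemma Rintegral_opp (f : R -> R) : bndsupp f ->
  \int[mu]_x f (- x) = \int[mu]_x f x.
Proof.
move=> fn; rewrite -[RHS]mul1r.
apply: (@Rintegral_transport (-%R : mR -> mR)) => //; last exact: bndsupp_integrable.
by move=> A mA; rewrite mul1e; exact: lebesgue_measureN.
Qed.

Lemma bndsupp_affine (f : R -> R) (a b : R) : 0 < a -> bndsupp f ->
  bndsupp (fun x => f (a * x + b)).
Proof.
move=> a0 fn; have [A [M [A0 M0 fM f0]]] := bndsupp_bound fn.
apply: (@bndsuppP _ _ ((A + `|b|) / a) M) => //.
  exact: (measurableT_comp (bndsupp_measurable fn) (measurable_affine a b)).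
move=> x; rewrite ltr_pdivrMr// => H; apply: f0.
have : `|x| * a = `|a * x| by rewrite normrM (gtr0_norm a0) mulrC.
have := ler_normB (a * x + b) b; rewrite addrK; lra.
Qed.

(* Both sides integrate [h y * v x * trig t (x * y)] over the plane. *)
Lemma ftrig_pairing t (h v : R -> R) : bndsupp h -> bndsupp v ->
  \int[mu]_x (ftrig t h x * v x) = \int[mu]_y (h y * ftrig t v y).
Proof.
move=> hn vn.
pose G (z : mR * mR) : R := trig t (z.1 * z.2) * h z.2 * v z.1.
have mG : measurable_fun setT G.
  apply: measurable_funM; last exact: (measurableT_comp (bndsupp_measurable vn)).
  apply: measurable_funM; last exact: (measurableT_comp (bndsupp_measurable hn)).
  by apply: (measurableT_comp (@measurable_trig R t)); exact: measurable_funM.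
have iG : (mu \x mu)%E.-integrable setT (EFin \o G).
  (* The kernel is at most 1 in modulus, so |G(x, y)| is dominated by |v x| |h y|, a product of
     integrable functions. *)
  apply/integrable12ltyP; first exact/measurable_EFinP.
  have Ih : (\int[mu]_y `|(h y)%:E| < +oo)%E.
    by have /integrableP[] := bndsupp_integrable hn.
  have Iv : (\int[mu]_x `|(v x)%:E| < +oo)%E.
    by have /integrableP[] := bndsupp_integrable vn.
  have mh : measurable_fun setT (fun y : mR => `|(h y)%:E|%E).
    by apply: measurableT_comp => //; apply/measurable_EFinP; exact: bndsupp_measurable.
  have mv : measurable_fun setT (fun y : mR => `|(v y)%:E|%E).
    by apply: measurableT_comp => //; apply/measurable_EFinP; exact: bndsupp_measurable.
  apply: (@le_lt_trans _ _ (\int[mu]_x (`|(v x)%:E| * \int[mu]_y `|(h y)%:E|))%E); last first.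
    rewrite ge0_integralZr//; last exact: integral_ge0.
    by rewrite lte_mul_pinfty// ?integral_ge0// ge0_fin_numE// integral_ge0.
  apply: ge0_le_integral => //.
  - by move=> x _; exact: integral_ge0.
  - apply: (@measurable_fun_fubini_tonelli_F _ _ _ _ _ mu (fun z => `|(EFin \o G) z|%E)) => //.
    by apply: measurableT_comp => //; exact/measurable_EFinP.
  - by apply: emeasurable_funM.
  move=> x _; rewrite -ge0_integralZl//.
  apply: ge0_le_integral => //.
  - apply: measurableT_comp => //; apply/measurable_EFinP.
    exact: (measurableT_comp mG (pair1_measurable x)).
  - by apply: emeasurable_funM.
  move=> y _; rewrite -!abseM /= lee_fin !normrM mulrC.
  by rewrite ler_wpM2l// ler_piMl// trig_le1.
have E1 : \int[mu]_x (ftrig t h x * v x) = fine (\int[mu]_x \int[mu]_y (EFin \o G) (x, y))%E.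
  congr fine; apply: eq_integral => x _.
  rewrite /ftrig -RintegralZr//; last exact/bndsupp_integrable/bndsupp_trigM.
  rewrite /Rintegral fineK//.
  apply: integrable_fin_num => //;
    apply: (@bndsupp_integrable _ (fun y => trig t (x * y) * h y * v x)).
  have -> : (fun y => trig t (x * y) * h y * v x) = (fun y => v x * (trig t (x * y) * h y)).
    by apply/funext => y; rewrite mulrC.
  exact/bndsuppZ/bndsupp_trigM.
rewrite E1 Fubini//; congr fine; apply: eq_integral => y _.
rewrite /ftrig -bndsupp_RintegralZ; last exact: bndsupp_trigM.
rewrite /Rintegral fineK.
  by apply: eq_integral => x _; rewrite /G /= (mulrC y); congr EFin; ring.
apply: integrable_fin_num => //.
exact: (@bndsupp_integrable _ (fun x => h y * (trig t (y * x) * v x)) (bndsuppZ _ (bndsupp_trigM _ _ vn))).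
Qed.

End change_of_variables.

(** * The bump of mass one *)

Section normalized_bump.
Context {R : realType}.
Local Open Scope classical_set_scope.
Local Notation mu := (@lebesgue_measure R).

Lemma bump0_supp (x : R) : 1 < `|x| -> bump0 x = 0.
Proof.
move=> x1; apply/eqP; apply: contraTT x1 => nz.
have : 0 < bump0 x by rewrite lt0r nz bump0_ge0.
by rewrite bump0_gt0 -leNgt; exact: ltW.
Qed.

Lemma bndsupp_bump0 : bndsupp (@bump0 R).
Proof.
apply: (@bndsupp_continuous _ _ 1); last exact: bump0_supp.
exact/smooth1_continuous/smooth1_bump0.
Qed.

Lemma Rintegral_gt0 (h : R -> R) (a : R) : bndsupp h -> (forall x, 0 <= h x) ->
  0 < a -> (forall x, `|x| <= a -> 0 < h x) -> continuous h ->
  0 < \int[mu]_x h x.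
Proof.
move=> hn h0 a0 hpos ch.
have [||c' c'a Hc'] := @EVT_min R h (- a) a; first by lra.
  by apply: continuous_subspaceT.
have hc : 0 < h c' by apply: hpos; move: c'a; rewrite in_itv/= ler_norml.
pose A : set R := `[- a, a].
have mA : measurable A by exact: measurable_itv.
have nA : bndsupp (fun x => h c' * \1_A x).
  apply: (@bndsuppP _ _ a (h c')) => //.
  - by apply: measurable_funM => //; exact: measurable_indic.
  - move=> x; rewrite indicE; case: (x \in A); rewrite ?mulr1 ?mulr0 ?normr0 ?gtr0_norm// ltW.
  - move=> x xa; rewrite indicE memNset ?mulr0//.
    by rewrite /A/= in_itv/= -ler_norml; apply/negP; rewrite -ltNge.
apply: (@lt_le_trans _ _ (\int[mu]_x (h c' * \1_A x))); last first.
  apply: bndsupp_le_Rintegral => // x; rewrite indicE.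
  case: (boolP (x \in A)) => [/set_mem|_]; last by rewrite mulr0.
  by rewrite mulr1 /A/= => xa; exact: Hc'.
have nA1 : bndsupp (\1_A : R -> R).
  have -> : (\1_A : R -> R) = (fun x => (h c')^-1 * (h c' * \1_A x)).
    by apply/funext => x; rewrite mulrA mulVf ?mul1r// gt_eqF.
  exact: bndsuppZ.
have muA : mu A = (a + a)%:E.
  rewrite lebesgue_measure_itv/= lte_fin ifT; last by lra.
  by rewrite -EFinB opprK.
rewrite bndsupp_RintegralZ// (_ : \int[mu]_x \1_A x = a + a);
  first by rewrite mulr_gt0// addr_gt0.
by rewrite /Rintegral integral_indic// setIT; exact: (congr1 fine muA).
Qed.

Definition bump_mass : R := \int[mu]_x bump0 x.

Lemma bump_mass_gt0 : 0 < bump_mass.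
Proof.
apply: (@Rintegral_gt0 _ 2^-1); first exact: bndsupp_bump0.
- exact: bump0_ge0.
- by lra.
- by move=> x x2; rewrite bump0_gt0; lra.
- exact/smooth1_continuous/smooth1_bump0.
Qed.

Definition bump (x : R) := bump_mass^-1 * bump0 x.

Lemma smooth1_bump : smooth1 bump.
Proof. by apply: (@smooth1M _ (cst _)); [exact: smooth1_cst|exact: smooth1_bump0]. Qed.

Lemma bump_ge0 x : 0 <= bump x.
Proof. by rewrite mulr_ge0 ?bump0_ge0// invr_ge0 ltW// bump_mass_gt0. Qed.

Lemma bump_supp x : 1 < `|x| -> bump x = 0.
Proof. by move=> x1; rewrite /bump bump0_supp// mulr0. Qed.

Lemma bumpN x : bump (- x) = bump x.
Proof. by rewrite /bump bump0N. Qed.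

Lemma bndsupp_bump : bndsupp bump.
Proof. exact/bndsuppZ/bndsupp_bump0. Qed.

Lemma Rintegral_bump : \int[mu]_x bump x = 1.
Proof.
rewrite bndsupp_RintegralZ; last exact: bndsupp_bump0.
by rewrite mulVf// gt_eqF// bump_mass_gt0.
Qed.

Lemma bump_le x : `|bump x| <= bump_mass^-1.
Proof.
rewrite ger0_norm ?bump_ge0//; apply: ler_piMr.
  by rewrite invr_ge0 ltW// bump_mass_gt0.
have flat_le1 y : flat 1 y <= 1 :> R.
  rewrite /flat; case: ifP => // y0; rewrite hornerC mul1r -expR0 ler_expR.
  by rewrite oppr_le0 invr_ge0 ltW.
by rewrite /bump0 mulr_ile1 ?flat1_ge0.
Qed.

End normalized_bump.

(** * Rudin-Shapiro polynomials *)

Section rudin_shapiro.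
Context {R : realType}.
Local Open Scope classical_set_scope.
Implicit Types (m k : nat) (q t : bool) (x y : R).

(* The coefficients of the Rudin-Shapiro pair of length 2^m: P for [q = true],
   Q for [q = false]. *)
Fixpoint rs m q k : R :=
  if m is m'.+1 then
    if (k < 2 ^ m')%N then rs m' true k
    else (if q then 1 else -1) * rs m' false (k - 2 ^ m')
  else 1.

Lemma rs_norm m q k : `|rs m q k| = 1.
Proof.
elim: m q k => [|m IH] q k /=; first by rewrite normr1.
case: ifP => _; first exact: IH.
by rewrite normrM IH mulr1; case: q; rewrite ?normrN normr1.
Qed.

(** The real ([t = true]) or imaginary part of P or Q at the point exp(i x) of the unit circle. *)
Definition rs_sum m q t x : R := \sum_(k < 2 ^ m) rs m q k * trig t (k%:R * x).

Lemma trigD t x y : trig t (x + y) =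
  trig t x * cos y + (if t then -1 else 1) * trig (~~ t) x * sin y.
Proof. by case: t => /=; rewrite ?cosD ?sinD; ring. Qed.

(** Real and imaginary parts of exp(i a) times the polynomial. It is used with a = 2^m x for the
    recursion, and with a small phase in [rs_sum_wave]. *)
Lemma rs_sum_shift m q t (a : R) x :
  \sum_(k < 2 ^ m) rs m q k * trig t (k%:R * x + a) =
  rs_sum m q t x * cos a + (if t then -1 else 1) * rs_sum m q (~~ t) x * sin a.
Proof.
rewrite /rs_sum mulr_suml mulr_sumr mulr_suml -big_split /=.
by apply: eq_bigr => k _; rewrite trigD; set s : R := if t then _ else _; ring.
Qed.

(** This is the Rudin-Shapiro recursion: the new pair is P + z^(2^m) Q and P - z^(2^m) Q. *)
Lemma rs_sumS m q t x : rs_sum m.+1 q t x = rs_sum m true t x +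
  (if q then 1 else -1) * (rs_sum m false t x * cos ((2 ^ m)%:R * x) +
   (if t then -1 else 1) * rs_sum m false (~~ t) x * sin ((2 ^ m)%:R * x)).
Proof.
rewrite -rs_sum_shift /rs_sum expnS mul2n -addnn big_split_ord /=.
congr (_ + _).
  by apply: eq_bigr => k _; rewrite ltn_ord.
rewrite mulr_sumr; apply: eq_bigr => k _.
rewrite ifF; last by apply/negbTE; rewrite -leqNgt leq_addr.
by rewrite addKn natrD mulrA; congr (_ * trig _ _); ring.
Qed.

(* The parallelogram identity for the pair (P, Q): |P|^2 + |Q|^2 = 2 * 2^m. *)
Lemma rs_identity m x :
  rs_sum m true true x ^+ 2 + rs_sum m true false x ^+ 2 +
  (rs_sum m false true x ^+ 2 + rs_sum m false false x ^+ 2) =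
  2 * (2 ^ m)%:R.
Proof.
elim: m => [|m IH].
  rewrite /rs_sum !expn0 !big_ord1 /= !mul0r cos0 sin0; ring.
rewrite !rs_sumS /= expnS natrM -IH.
have := cos2Dsin2 ((2 ^ m)%:R * x).
set c := cos _; set s := sin _ => cs.
set a := rs_sum _ _ _ _; set b := rs_sum _ _ _ _; set d := rs_sum _ _ _ _.
set e := rs_sum _ _ _ _.
transitivity (2 * (a ^+ 2 + e ^+ 2) + 2 * (b ^+ 2 + d ^+ 2) * (c ^+ 2 + s ^+ 2)).
  by ring.
by rewrite cs; ring.
Qed.

(** Flatness: the sup norm exceeds the quadratic mean sqrt N by a factor at most sqrt 2. This is
    what keeps the norms of [wave] of order sqrt N. *)
Lemma rs_sum2_le m q x :
  rs_sum m q true x ^+ 2 + rs_sum m q false x ^+ 2 <= 2 * (2 ^ m)%:R.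
Proof.
rewrite -(rs_identity m x); case: q.
  by rewrite lerDl addr_ge0// sqr_ge0.
by rewrite lerDr addr_ge0// sqr_ge0.
Qed.

Lemma rs_sum_le m q t x : `|rs_sum m q t x| <= Num.sqrt (2 * (2 ^ m)%:R).
Proof.
rewrite -sqrtr_sqr ler_wsqrtr//; apply: le_trans (rs_sum2_le m q x).
by case: t; rewrite ?lerDl ?lerDr sqr_ge0.
Qed.

Lemma measurable_rs_sum m q t : measurable_fun setT (rs_sum m q t).
Proof.
apply: measurable_sum => k; apply: measurable_funM => //.
by apply: (measurableT_comp (@measurable_trig R t)); exact: measurable_funM.
Qed.

Lemma smooth1_trig t : smooth1 (@trig R t).
Proof.
have H s c : (forall x, derivable (fun x => c * trig s x) x 1) /\
    (fun x => c * trig s x)^`() =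
    (fun x : R => (if s then - c else c) * trig (~~ s) x).
  have D x : is_derive x 1 (fun x => c * trig s x) ((if s then - c else c) * trig (~~ s) x).
    apply: (@is_derive_eq _ _ _ (fun x => c * trig s x) _ _ _ (c * (if s then - sin x else cos x))); last first.
      by case: s => /=; ring.
    apply: (@is_deriveZ _ _ _ (trig s) c).
    by case: s; [exact: is_derive_cos|exact: is_derive_sin].
  split=> [x|]; first exact: (@ex_derive _ _ _ _ _ _ _ (D x)).
  by apply/funext => x; rewrite derive1E; exact: (@derive_val _ _ _ _ _ _ _ (D x)).
apply: (@smooth1_closed _ [set f | exists s c, f = fun x => c * trig s x]); last first.
  by exists t, 1; apply/funext => x; rewrite mul1r.
move=> _ [s [c ->]]; have [h1 h2] := H s c; split=> //.
by exists (~~ s), (if s then - c else c).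
Qed.

Lemma smooth1_rs_sum m q t : smooth1 (rs_sum m q t).
Proof.
apply: (@smooth1_sum _ _ _ (fun (k : 'I_(2 ^ m)) x => rs m q k * trig t (k%:R * x))) => k.
apply: (@smooth1M _ (cst _)); first exact: smooth1_cst.
have -> : (fun x => trig t (k%:R * x)) = (fun x => trig t (k%:R * x + 0)).
  by apply/funext => x; rewrite addr0.
exact/smooth1_affine/smooth1_trig.
Qed.

(** As [bump] has mass 1, integrating [rs_identity] gives 2N as the sum of the four integrals, so
    one of them reaches N/2. Which one may depend on [m]. *)
Lemma rs_sum_mass m : exists q t,
  (2 ^ m)%:R / 2 <= \int[lebesgue_measure]_x (bump x * rs_sum m q t x ^+ 2).
Proof.
pose I q t := \int[lebesgue_measure]_x (bump x * rs_sum m q t x ^+ 2).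
have n q t : bndsupp (fun x => bump x * rs_sum m q t x ^+ 2).
  have -> : (fun x => bump x * rs_sum m q t x ^+ 2) =
      (fun x => rs_sum m q t x * (rs_sum m q t x * bump x)).
    by apply/funext => x; ring.
  by do 2 (apply: bndsuppM; [|exact: measurable_rs_sum|by move=> x; exact: rs_sum_le]);
    exact: bndsupp_bump.
have E : I true true + I true false + (I false true + I false false) =
    2 * (2 ^ m)%:R.
  rewrite /I -!bndsupp_RintegralD//; try exact: bndsuppD.
  transitivity (\int[lebesgue_measure]_x (2 * (2 ^ m)%:R * bump x) : R).
    by apply: eq_Rintegral => x _; rewrite -(rs_identity m x); ring.
  rewrite bndsupp_RintegralZ; last exact: bndsupp_bump.
  by rewrite Rintegral_bump mulr1.
have [h|h] := leP ((2 ^ m)%:R / 2) (I true true); first by exists true, true.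
have [h1|h1] := leP ((2 ^ m)%:R / 2) (I true false); first by exists true, false.
have [h2|h2] := leP ((2 ^ m)%:R / 2) (I false true); first by exists false, true.
by exists false, false; rewrite -/(I false false); lra.
Qed.

End rudin_shapiro.

(** * The lower bound on the line *)

Section one_dimensional_pairing.
Context {R : realType}.
Local Open Scope classical_set_scope.
Local Notation mu := (@lebesgue_measure R).
Variable m : nat.
Let N : R := (2 ^ m)%:R.
Implicit Types (q t : bool) (x y xi theta : R).

Let N1 : 1 <= N. Proof. by rewrite ler1n expn_gt0. Qed.
Let N0 : 0 < N. Proof. exact: lt_le_trans N1. Qed.

Definition conc x : R := (2 ^ m)%:R * bump ((2 ^ m)%:R * x).

Lemma conc_ge0 x : 0 <= conc x.
Proof. by rewrite mulr_ge0// bump_ge0. Qed.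

Lemma conc_supp x : N^-1 < `|x| -> conc x = 0.
Proof.
move=> xN; rewrite /conc bump_supp ?mulr0// normrM gtr0_norm//.
by rewrite mulrC -ltr_pdivrMr// div1r.
Qed.

Lemma concN x : conc (- x) = conc x.
Proof. by rewrite /conc mulrN bumpN. Qed.

Lemma smooth1_conc : smooth1 conc.
Proof.
apply: (@smooth1M _ (cst _)); first exact: smooth1_cst.
have -> : (fun x => bump ((2 ^ m)%:R * x)) = (fun x : R => bump ((2 ^ m)%:R * x + 0)).
  by apply/funext => x; rewrite addr0.
exact/smooth1_affine/smooth1_bump.
Qed.

Lemma bndsupp_conc : bndsupp conc.
Proof.
apply: (@bndsupp_continuous _ _ N^-1); last exact: conc_supp.
exact/smooth1_continuous/smooth1_conc.
Qed.

Lemma Rintegral_conc : \int[mu]_x conc x = 1.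
Proof.
have nb : bndsupp (fun x : R => bump (N * x)).
  have -> : (fun x : R => bump (N * x)) = (fun x => bump (N * x + 0)).
    by apply/funext => x; rewrite addr0.
  exact/bndsupp_affine/bndsupp_bump.
rewrite bndsupp_RintegralZ//.
transitivity (N * \int[mu]_x bump (N * x + 0)).
  by congr (_ * _); apply: eq_Rintegral => x _; rewrite addr0.
rewrite Rintegral_affine//; last exact: bndsupp_bump.
by rewrite Rintegral_bump mulr1 mulfV// gt_eqF.
Qed.

Lemma ftrig_sin_even (h : R -> R) xi : bndsupp h -> (forall x, h (- x) = h x) ->
  ftrig false h xi = 0.
Proof.
move=> hn heven; have E : ftrig false h xi = - ftrig false h xi.
  rewrite -mulN1r {1}/ftrig -bndsupp_RintegralZ; last exact: bndsupp_trigM.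
  rewrite -Rintegral_opp; last exact: bndsupp_trigM.
  by apply: eq_Rintegral => y _; rewrite heven /trig mulrN sinN; ring.
by lra.
Qed.

Lemma cos_ge_quadratic y : 1 - y ^+ 2 / 2 <= cos y.
Proof.
have -> : cos y = 1 - 2 * sin (y / 2) ^+ 2.
  have -> : cos y = cos (y / 2 + y / 2) by congr cos; lra.
  rewrite cosD; have := cos2Dsin2 (y / 2); rewrite !expr2; lra.
have := trig_lip false (y / 2) 0; rewrite /trig sin0 !subr0 => H.
have : sin (y / 2) ^+ 2 <= (y / 2) ^+ 2.
  by rewrite -(real_normK (num_real (sin _))) -(real_normK (num_real (y / 2))) lerXn2r ?nnegrE.
rewrite !expr2; lra.
Qed.

Local Notation A := (ftrig true conc).

(** On the support of [conc] one has |xi y| at most 1, where the cosine is at least 1/2, and [conc]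
    has mass 1. *)
Lemma ftrig_conc_ge xi : `|xi| <= N -> 1 / 2 <= A xi.
Proof.
move=> xiN; rewrite -[leLHS]mulr1 -[X in _ * X <= _]Rintegral_conc -bndsupp_RintegralZ;
  last exact: bndsupp_conc.
apply: bndsupp_le_Rintegral; [exact/bndsuppZ/bndsupp_conc|exact/bndsupp_trigM/bndsupp_conc|].
move=> y; have [yN|yN] := leP `|y| N^-1; last by rewrite conc_supp// !mulr0.
rewrite ler_wpM2r ?conc_ge0//; apply: le_trans (cos_ge_quadratic _).
have : `|xi * y| <= 1.
  by rewrite normrM -(mulfV (lt0r_neq0 N0)) ler_pM.
rewrite -(expr_le1 (n := 2))// real_normK ?num_real//; lra.
Qed.

(** The Lipschitz constant is the first absolute moment, and [conc] is a probability density
    supported in |y| at most 1/N. *)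
Lemma ftrig_conc_lip xi xi' : `|A xi - A xi'| <= `|xi - xi'| / N.
Proof.
apply: le_trans (ftrig_lip true xi xi' bndsupp_conc) _.
rewrite ler_wpM2l// -[N^-1]mulr1 -Rintegral_conc -bndsupp_RintegralZ; last exact: bndsupp_conc.
apply: bndsupp_le_Rintegral; [exact/bndsupp_norm/bndsupp_id/bndsupp_conc|exact/bndsuppZ/bndsupp_conc|].
move=> y; have [yN|yN] := leP `|y| N^-1; last by rewrite conc_supp// !mulr0 normr0.
by rewrite normrM (ger0_norm (conc_ge0 _)) ler_wpM2r ?conc_ge0.
Qed.

Definition wave q t x : R := rs_sum m q t x * bump x.

Lemma smooth1_wave q t : smooth1 (wave q t).
Proof. by apply: smooth1M; [exact: smooth1_rs_sum|exact: smooth1_bump]. Qed.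

Lemma wave_supp q t x : 1 < `|x| -> wave q t x = 0.
Proof. by move=> x1; rewrite /wave bump_supp ?mulr0. Qed.

Lemma bndsupp_wave q t : bndsupp (wave q t).
Proof.
apply: (@bndsupp_continuous _ _ 1); last exact: wave_supp.
exact/smooth1_continuous/smooth1_wave.
Qed.

Lemma ftrig_wave_le q t s xi : `|ftrig s (wave q t) xi| <= Num.sqrt (2 * N).
Proof.
apply: le_trans (ftrig_bounded s xi (bndsupp_wave q t)) _.
rewrite -[leRHS]mulr1 -[X in _ <= _ * X]Rintegral_bump -bndsupp_RintegralZ;
  last exact: bndsupp_bump.
apply: bndsupp_le_Rintegral; [exact/bndsupp_norm/bndsupp_wave|exact/bndsuppZ/bndsupp_bump|].
move=> x; rewrite normrM (ger0_norm (bump_ge0 _)) ler_wpM2r ?bump_ge0//.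
exact: rs_sum_le.
Qed.

(* The factor [1 / A k] compensates for the variation of the transform of
   [conc] along the frequencies [k < 2 ^ m]. *)
Definition symb_coef q (k : nat) : R := rs m q k / A k%:R.

(* The bump at [k] has radius [1 / 16], on which the transforms of [conc] and
   [wave] vary little. *)
Definition symb q xi : R :=
  \sum_(k < 2 ^ m) symb_coef q k * bump (16 * xi - 16 * k%:R).

Let A_nat (k : 'I_(2 ^ m)) : 1 / 2 <= A k%:R.
Proof. by apply: ftrig_conc_ge; rewrite ger0_norm// ler_nat ltnW. Qed.

Lemma symb_coef_le q (k : 'I_(2 ^ m)) : `|symb_coef q k| <= 2.
Proof.
rewrite /symb_coef normrM rs_norm mul1r normfV; have H := A_nat k.
move: (A _) H => a H; have a0 : 0 < a by lra.
by rewrite gtr0_norm// invf_ple ?posrE//; lra.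
Qed.

Lemma smooth1_symb q : smooth1 (symb q).
Proof.
apply: (@smooth1_sum _ _ _ (fun (k : 'I_(2 ^ m)) x => symb_coef q k * bump (16 * x - 16 * k%:R))) => k.
apply: (@smooth1M _ (cst _)); first exact: smooth1_cst.
exact/smooth1_affine/smooth1_bump.
Qed.

Lemma derive1n_symb q n : derive1n n (symb q) = fun xi =>
  \sum_(k < 2 ^ m) symb_coef q k * (16 ^+ n * derive1n n bump (16 * xi - 16 * k%:R)).
Proof.
have sb (k : 'I_(2 ^ m)) : smooth1 (fun x : R => bump (16 * x - 16 * k%:R)).
  exact/smooth1_affine/smooth1_bump.
rewrite /symb (@derive1n_sum _ _ _ (fun (k : 'I_(2 ^ m)) x => symb_coef q k * bump (16 * x - 16 * k%:R))).
  apply/funext => xi; apply: eq_bigr => k _.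
  by rewrite derive1nZ// derive1n_affine//; exact: smooth1_bump.
move=> k; apply: (@smooth1M _ (cst _)); first exact: smooth1_cst.
exact: sb.
Qed.

Lemma derive1n_bump_supp n x : 1 < `|x| -> derive1n n bump x = 0 :> R.
Proof.
move=> x1; apply: (@derive1n_support _ _ (-1) 1) => [y y1|].
  by apply: bump_supp; rewrite ltNge ler_norml; apply/negP => /andP[]; case: y1; lra.
by move: x1; rewrite ltNge ler_norml negb_and -!ltNge => /orP[]; [left|right].
Qed.

Lemma derive1n_symb_supp q n xi : N < `|xi| -> derive1n n (symb q) xi = 0.
Proof.
move=> xiN; rewrite derive1n_symb big1// => k _.
rewrite derive1n_bump_supp ?mulr0//.
(* The last centre is N - 1, which leaves room for a bump of radius below 1 inside |xi| at most
   N. *)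
have kN : k%:R + 1 <= N by rewrite natr1 ler_nat.
have k0 : 0 <= k%:R :> R by [].
move: xiN; rewrite !ltNge; apply: contra.
by rewrite !ler_norml => /andP[h1 h2]; apply/andP; split; lra.
Qed.

(** After the dilation by 16 distinct centres are at least 16 apart while [bump] has radius 1, so at
    most one term is nonzero at each point and the bound does not see [m]. *)
Lemma derive1n_symb_le q n (M : R) : (forall x, `|derive1n n bump x| <= M) ->
  forall xi, `|derive1n n (symb q) xi| <= 2 * (16 ^+ n * M).
Proof.
move=> HM xi; have M0 : 0 <= M := le_trans (normr_ge0 _) (HM 0).
have M'0 : 0 <= 2 * (16 ^+ n * M) by rewrite !mulr_ge0// exprn_ge0.
rewrite derive1n_symb.
have [/existsP[k /eqP kne]|] := boolP [exists k : 'I_(2 ^ m),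
    derive1n n bump (16 * xi - 16 * k%:R) != 0]; last first.
  move=> /existsPn H; rewrite big1 ?normr0// => k _.
  by have := H k; rewrite negbK => /eqP ->; rewrite !mulr0.
rewrite (bigD1 k)//= big1 ?addr0 => [|j jk].
  rewrite normrM; apply: ler_pM; [exact: normr_ge0|exact: normr_ge0| |].
    exact: symb_coef_le.
  by rewrite normrM normrX ger0_norm// ler_wpM2l// exprn_ge0.
rewrite derive1n_bump_supp ?mulr0//.
have : `|16 * xi - 16 * k%:R| <= 1.
  by rewrite leNgt; apply/negP => /(derive1n_bump_supp n).
have : 1 <= `|j%:R - k%:R| :> R.
  rewrite ler_normr; apply/orP.
  have [lt_jk|lt_kj|/val_inj eq_jk] := ltngtP (j : nat) k; last by rewrite eq_jk eqxx in jk.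
    by right; have : j%:R + 1 <= k%:R :> R; [rewrite natr1 ler_nat|lra].
  by left; have : k%:R + 1 <= j%:R :> R; [rewrite natr1 ler_nat|lra].
rewrite ler_normr ler_norml => H /andP[h1 h2]; rewrite ltNge ler_norml.
by apply/negP => /andP[h3 h4]; case/orP: H; lra.
Qed.

Lemma bndsupp_symb q : bndsupp (symb q).
Proof.
apply: (@bndsupp_continuous _ _ N); last exact: (@derive1n_symb_supp q 0).
exact/smooth1_continuous/smooth1_symb.
Qed.

(** For theta = 0 the sum equals the integral in the hypothesis, because summing the kernels against
    the signs reproduces [rs_sum]. In general each kernel acquires the phase theta y, of modulus at
    most 1/16 on the support of [bump]. *)
Lemma rs_sum_wave q t theta :
  N / 2 <= \int[mu]_x (bump x * rs_sum m q t x ^+ 2) -> `|theta| <= 1 / 16 ->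
  2 / 5 * N <= \sum_(k < 2 ^ m) rs m q k * ftrig t (wave q t) (k%:R + theta).
Proof.
move=> HI th.
have nk (k : 'I_(2 ^ m)) :
    bndsupp (fun y : R => rs m q k * (trig t ((k%:R + theta) * y) * wave q t y)).
  exact/bndsuppZ/bndsupp_trigM/bndsupp_wave.
have -> : \sum_(k < 2 ^ m) rs m q k * ftrig t (wave q t) (k%:R + theta) =
    \int[mu]_y (\sum_(k < 2 ^ m) rs m q k * (trig t ((k%:R + theta) * y) * wave q t y)).
  rewrite bndsupp_Rintegral_sum//; apply: eq_bigr => k _.
  by rewrite bndsupp_RintegralZ//; exact/bndsupp_trigM/bndsupp_wave.
have nR : bndsupp (fun x : R => bump x * rs_sum m q t x ^+ 2).
  have -> : (fun x : R => bump x * rs_sum m q t x ^+ 2) =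
      (fun x => rs_sum m q t x * wave q t x).
    by apply/funext => x; rewrite /wave; ring.
  by apply: bndsuppM; [exact: bndsupp_wave|exact: measurable_rs_sum|exact: rs_sum_le].
(* 511/512 = 1 - (1/16)^2 / 2 bounds the cosine of the phase from below, and N/16 bounds the term
   with its sine. What remains is 511/1024 - 1/16 > 2/5. *)
apply: (@le_trans _ _ (\int[mu]_y (511 / 512 * (bump y * rs_sum m q t y ^+ 2) +
    - (N / 16) * bump y))).
  rewrite bndsupp_RintegralD; [|exact: bndsuppZ|exact/bndsuppZ/bndsupp_bump].
  rewrite bndsupp_RintegralZ// bndsupp_RintegralZ; last exact: bndsupp_bump.
  rewrite Rintegral_bump mulr1; move: HI; move: (\int[mu]_x _) => X HI; have := N0; lra.
apply: bndsupp_le_Rintegral.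
- by apply: bndsuppD; [exact: bndsuppZ|exact/bndsuppZ/bndsupp_bump].
- exact: bndsupp_sum.
move=> y; have -> : \sum_(k < 2 ^ m) rs m q k * (trig t ((k%:R + theta) * y) * wave q t y) =
    (\sum_(k < 2 ^ m) rs m q k * trig t (k%:R * y + theta * y)) * wave q t y.
  by rewrite mulr_suml; apply: eq_bigr => k _; rewrite mulrA mulrDl.
rewrite rs_sum_shift /wave.
have [y1|y1] := leP `|y| 1; last by rewrite bump_supp// !(mulr0, mul0r) addr0.
have thy : `|theta * y| <= 1 / 16.
  by rewrite normrM -[leRHS]mulr1 ler_pM.
have C : 511 / 512 <= cos (theta * y).
  apply: le_trans (cos_ge_quadratic _).
  have : (theta * y) ^+ 2 <= (1 / 16) ^+ 2.
    by rewrite -(real_normK (num_real (theta * y))) lerXn2r ?nnegrE//; lra.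
  rewrite !expr2; lra.
have S : `|sin (theta * y)| <= 1 / 16.
  have := trig_lip false (theta * y) 0; rewrite /trig sin0 !subr0 => H.
  exact: le_trans H thy.
have S2 : `|(if t then -1 else 1) * sin (theta * y)| <= 1 / 16.
  have -> : `|(if t then -1 else 1) * sin (theta * y)| = `|sin (theta * y)|.
    by case: (t); rewrite ?mulN1r ?mul1r ?normrN.
  exact: S.
have Q : rs_sum m q t y ^+ 2 + rs_sum m q (~~ t) y ^+ 2 <= 2 * N.
  by have := rs_sum2_le m q y; case: (t) => //=; rewrite addrC.
have b0 := bump_ge0 y.
move: (rs_sum m q t y) (rs_sum m q (~~ t) y) Q => r r' Q.
rewrite [X in (_ + X) * _](_ : _ = r' * ((if t then -1 else 1) * sin (theta * y))); last first.
  by set s : R := if t then _ else _; ring.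
move: S2 C; set s := (_ * sin _); set c := cos _ => S2 C.
have K : 511 / 512 * r ^+ 2 - N / 16 <= (r * c + r' * s) * r.
  have c2 : 511 / 512 * r ^+ 2 <= c * r ^+ 2 by rewrite ler_wpM2r ?sqr_ge0.
  (* From 2 |r r'| <= r^2 + r'^2 <= 2N. *)
  have : `|r' * s * r| <= N / 16.
    rewrite (normrM _ r) (normrM r') mulrAC; apply: (@le_trans _ _ (N * (1 / 16)));
      last by lra.
    apply: ler_pM; [exact: mulr_ge0|exact: normr_ge0| |exact: S2].
    rewrite -normrM ler_norml.
    have := sqr_ge0 (r + r'); have := sqr_ge0 (r - r'); rewrite sqrrB sqrrD.
    by move=> h1 h2; apply/andP; split; lra.
  rewrite ler_norml => /andP[h _].
  have -> : (r * c + r' * s) * r = c * r ^+ 2 + r' * s * r by ring.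
  lra.
have -> : 511 / 512 * (bump y * r ^+ 2) + - (N / 16) * bump y =
    bump y * (511 / 512 * r ^+ 2 - N / 16) by ring.
have -> : (r * c + r' * s) * (r * bump y) = bump y * ((r * c + r' * s) * r) by ring.
exact: ler_wpM2l.
Qed.

Lemma sqrt2_le (y : R) : 1 <= y -> Num.sqrt (2 * y) <= 3 / 2 * y.
Proof.
move=> y1; rewrite -[leRHS]ger0_norm; last by lra.
rewrite -sqrtr_sqr ler_wsqrtr//.
have : y <= y * y by rewrite ler_peMl//; lra.
rewrite !expr2; lra.
Qed.

(** Moving every bump to the origin turns the pairing into an integral over one common offset, with
    the sum over the lattice inside; this sum is then estimated for each fixed offset. *)
Lemma Rintegral_translates n (c z : 'I_n -> R) (g H : R -> R) (K : R) :
  bndsupp g -> measurable_fun setT H -> (forall x, `|H x| <= K) ->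
  \int[mu]_x ((\sum_(k < n) c k * g (x - z k)) * H x) =
  \int[mu]_x ((\sum_(k < n) c k * H (x + z k)) * g x).
Proof.
move=> ng mH HK.
have n1 k : bndsupp (fun x => H x * g (x - z k)).
  apply: (bndsuppM _ mH HK).
  have := bndsupp_affine (- z k) ltr01 ng.
  by congr (bndsupp _); apply/funext => x; rewrite mul1r.
have n2 k : bndsupp (fun x => H (x + z k) * g x).
  apply: (bndsuppM ng _ (fun x => HK (x + z k))).
  by apply: (measurableT_comp mH); exact: measurable_funD.
transitivity (\sum_(k < n) c k * \int[mu]_x (H x * g (x - z k))).
  transitivity (\int[mu]_x (\sum_(k < n) c k * (H x * g (x - z k)))).
    apply: eq_Rintegral => x _; rewrite mulr_suml.
    by apply: eq_bigr => k _; ring.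
  rewrite bndsupp_Rintegral_sum; last by move=> k; exact: (bndsuppZ _ (n1 k)).
  by apply: eq_bigr => k _; exact: (bndsupp_RintegralZ _ (n1 k)).
transitivity (\sum_(k < n) c k * \int[mu]_x (H (x + z k) * g x)); last first.
  transitivity (\int[mu]_x (\sum_(k < n) c k * (H (x + z k) * g x))); last first.
    apply: eq_Rintegral => x _; rewrite mulr_suml.
    by apply: eq_bigr => k _; ring.
  rewrite bndsupp_Rintegral_sum; last by move=> k; exact: (bndsuppZ _ (n2 k)).
  by apply: eq_bigr => k _; apply/esym; exact: (bndsupp_RintegralZ _ (n2 k)).
apply: eq_bigr => k _; congr (_ * _).
rewrite -[LHS]mul1r -invr1 -(Rintegral_affine (z k) ltr01 (n1 k)).
by apply: eq_Rintegral => x _; rewrite mul1r addrK.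
Qed.

(** At offset theta the lattice sum contains A(k + theta). Replaced by A(k) it cancels the
    denominator of [symb_coef], leaving the sum of [rs_sum_wave]; the replacement costs little by
    [ftrig_conc_lip]. *)
Lemma pairing_ge q t : N / 2 <= \int[mu]_x (bump x * rs_sum m q t x ^+ 2) ->
  N / 128 <= \int[mu]_xi (symb q xi * (A xi * ftrig t (wave q t) xi)).
Proof.
move=> HI; set E := ftrig t (wave q t).
have mA : measurable_fun setT A by apply: measurable_ftrig; exact: bndsupp_conc.
have mE : measurable_fun setT E by apply: measurable_ftrig; exact: bndsupp_wave.
have A1 xi : `|A xi| <= 1.
  apply: le_trans (ftrig_bounded true xi bndsupp_conc) _; rewrite -[leRHS]Rintegral_conc.
  rewrite le_eqVlt; apply/orP; left; apply/eqP.
  by apply: eq_Rintegral => x _; rewrite ger0_norm ?conc_ge0.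
have E1 xi : `|E xi| <= Num.sqrt (2 * N) by exact: ftrig_wave_le.
have mAE : measurable_fun setT (fun xi => A xi * E xi) := measurable_funM mA mE.
have AE1 xi : `|A xi * E xi| <= Num.sqrt (2 * N).
  by rewrite normrM -[leRHS]mul1r; apply: ler_pM;
    [exact: normr_ge0|exact: normr_ge0|exact: A1|exact: E1].
have nb16 : bndsupp (fun th : R => bump (16 * th + 0)).
  exact/bndsupp_affine/bndsupp_bump.
have -> : \int[mu]_xi (symb q xi * (A xi * E xi)) =
    \int[mu]_th ((\sum_(k < 2 ^ m) symb_coef q k *
      (A (th + k%:R) * E (th + k%:R))) * bump (16 * th + 0)).
  rewrite -(Rintegral_translates (symb_coef q) (fun k => k%:R) nb16 mAE AE1).
  apply: eq_Rintegral => xi _; congr (_ * _); apply: eq_bigr => k _.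
  by congr (_ * bump _); rewrite addr0 mulrBr.
have Ib : \int[mu]_th bump (16 * th + 0) = 1 / 16.
  by rewrite Rintegral_affine//; [rewrite Rintegral_bump mulr1; lra|exact: bndsupp_bump].
(* At each offset the lattice sum is at least (2/5 - 3/16) N > N/8; the dilated bump has mass
   1/16. *)
have -> : N / 128 = \int[mu]_th (N / 8 * bump (16 * th + 0)).
  by rewrite bndsupp_RintegralZ// Ib; lra.
have nR : bndsupp (fun th => (\sum_(k < 2 ^ m) symb_coef q k *
      (A (th + k%:R) * E (th + k%:R))) * bump (16 * th + 0)).
  rewrite (_ : (fun th => _) = (fun th => \sum_(k < 2 ^ m) symb_coef q k *
      ((A (th + k%:R) * E (th + k%:R)) * bump (16 * th + 0)))); last first.
    by apply/funext => th; rewrite mulr_suml; apply: eq_bigr => k _; apply/esym; exact: mulrA.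
  apply: bndsupp_sum => k; apply: bndsuppZ.
  apply: (@bndsuppM _ (fun th => bump (16 * th + 0))
    (fun th => A (th + k%:R) * E (th + k%:R)) (Num.sqrt (2 * N)) nb16).
    by apply: (measurableT_comp mAE); exact: measurable_funD.
  by move=> th; exact: AE1.
apply: bndsupp_le_Rintegral => //; first exact: bndsuppZ.
move=> th; have [th1|th1] := leP `|th| (1 / 16); last first.
  rewrite bump_supp ?mulr0//.
  by rewrite addr0 normrM ger0_norm//; lra.
rewrite ler_wpM2r ?bump_ge0//.
have -> : \sum_(k < 2 ^ m) symb_coef q k * (A (th + k%:R) * E (th + k%:R)) =
    \sum_(k < 2 ^ m) rs m q k * E (k%:R + th) +
    \sum_(k < 2 ^ m) symb_coef q k * (A (th + k%:R) - A k%:R) * E (k%:R + th).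
  rewrite -big_split /=; apply: eq_bigr => k _; rewrite /symb_coef (addrC th).
  have Ak := A_nat k; have Ak0 : A k%:R != 0 by apply: lt0r_neq0; apply: lt_le_trans Ak; lra.
  by move: (A _) (A _) Ak0 => a a' a0; field.
have main := rs_sum_wave HI th1.
(* There are N terms: each coefficient is at most 2, the variation of A at most 1/(16N), and E at
   most sqrt(2N). The total sqrt(2N)/8 is at most 3N/16 by [sqrt2_le]. *)
have err : `|\sum_(k < 2 ^ m) symb_coef q k * (A (th + k%:R) - A k%:R) * E (k%:R + th)|
    <= N * (2 * (1 / 16 / N) * Num.sqrt (2 * N)).
  apply: le_trans (ler_norm_sum _ _ _) _.
  rewrite {1}/N -[X in X%:R]card_ord -sum1_card natr_sum mulr_suml ler_sum// => k _.
  rewrite [leRHS]mul1r normrM; apply: ler_pM; [exact: normr_ge0|exact: normr_ge0| |exact: E1].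
  rewrite normrM; apply: ler_pM; [exact: normr_ge0|exact: normr_ge0|exact: symb_coef_le|].
  apply: le_trans (ftrig_conc_lip _ _) _.
  by rewrite addrK ler_pM2r// invr_gt0.
have sq := sqrt2_le N1.
have E2 : N * (2 * (1 / 16 / N) * Num.sqrt (2 * N)) = Num.sqrt (2 * N) / 8.
  by field; exact: lt0r_neq0.
move: err; rewrite E2 ler_norml => /andP[e1 _].
rewrite -/E in main; move: main e1 sq; clear -N0.
move: N N0 (\sum_(k < 2 ^ m) rs m q k * E (k%:R + th)) (\sum_(k < 2 ^ m) _) (Num.sqrt (2 * N)).
by move=> M M0 X Y Z; lra.
Qed.

End one_dimensional_pairing.

(** * Multiplier operators on the line: pairings and Hoelder's inequality *)

Section one_dimensional_operator.
Context {R : realType}.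
Local Open Scope classical_set_scope.
Local Open Scope complex_scope.
Local Open Scope ring_scope.
Local Notation mu := (@lebesgue_measure R).
Local Notation Re := (@complex.Re R).
Local Notation Im := (@complex.Im R).
Local Notation normc := (@normc R).

Definition cintegral1 (f : R -> R[i]) : R[i] :=
  (\int[mu]_x Re (f x)) +i* (\int[mu]_x Im (f x)).

Definition cbndsupp (f : R -> R[i]) := bndsupp (Re \o f) /\ bndsupp (Im \o f).

Definition fhat (u : R -> R) (xi : R) : R[i] :=
  cintegral1 (fun x => expi (- (x * xi)) * (u x)%:C).

Definition multiplier1 (sigma u : R -> R) (x : R) : R[i] :=
  ((2 * pi)^-1)%:C * cintegral1 (fun xi => expi (xi * x) * (sigma xi)%:C * fhat u xi).

Lemma ReM (z w : R[i]) : Re (z * w) = Re z * Re w - Im z * Im w.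
Proof. by case: z w => [a b] [c d]. Qed.

Lemma ImM (z w : R[i]) : Im (z * w) = Re z * Im w + Im z * Re w.
Proof. by case: z w => [a b] [c d]. Qed.

Lemma Re_fourier_kernel (u : R -> R) xi :
  Re \o (fun x => expi (- (x * xi)) * (u x)%:C) = (fun x => trig true (xi * x) * u x).
Proof. by apply/funext => x /=; rewrite mulr0 subr0 cosN mulrC (mulrC x) mulrC. Qed.

Lemma Im_fourier_kernel (u : R -> R) xi :
  Im \o (fun x => expi (- (x * xi)) * (u x)%:C) =
  (fun x => -1 * (trig false (xi * x) * u x)).
Proof. by apply/funext => x /=; rewrite mulr0 add0r sinN (mulrC x) mulN1r mulNr. Qed.

Lemma cbndsupp_fourier_kernel u xi : bndsupp u ->
  cbndsupp (fun x => expi (- (x * xi)) * (u x)%:C).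
Proof.
move=> un; split; first by rewrite Re_fourier_kernel; exact: bndsupp_trigM.
by rewrite Im_fourier_kernel; exact/bndsuppZ/bndsupp_trigM.
Qed.

Lemma fhatE u xi : bndsupp u -> fhat u xi = ftrig true u xi +i* (- ftrig false u xi).
Proof.
move=> un; congr (_ +i* _).
  by rewrite -[LHS]/(\int[mu]_x (Re \o (fun x => expi (- (x * xi)) * (u x)%:C)) x) Re_fourier_kernel.
rewrite -[LHS]/(\int[mu]_x (Im \o (fun x => expi (- (x * xi)) * (u x)%:C)) x) Im_fourier_kernel.
by rewrite bndsupp_RintegralZ ?mulN1r//; exact: bndsupp_trigM.
Qed.

Section kernel.
Variables (sigma u : R -> R).
Hypotheses (sn : bndsupp sigma) (un : bndsupp u).
Let A := ftrig true u.
Let S := ftrig false u.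
Let sA xi := A xi * sigma xi.
Let sS xi := S xi * sigma xi.

Let nsA : bndsupp sA.
Proof. by apply: (bndsuppM sn (measurable_ftrig true un)) => x; exact: ftrig_bounded. Qed.

Let nsS : bndsupp sS.
Proof. by apply: (bndsuppM sn (measurable_ftrig false un)) => x; exact: ftrig_bounded. Qed.

Let K x xi := expi (xi * x) * (sigma xi)%:C * fhat u xi.

Let ReK x : Re \o K x = fun xi => trig true (x * xi) * sA xi + trig false (x * xi) * sS xi.
Proof.
apply/funext => xi; rewrite -[LHS]/(Re (expi (xi * x) * (sigma xi)%:C * fhat u xi)) fhatE// !ReM !ImM /= (mulrC xi) /sA /sS /A /S; ring.
Qed.

Let ImK x : Im \o K x = fun xi => trig false (x * xi) * sA xi + -1 * (trig true (x * xi) * sS xi).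
Proof.
apply/funext => xi; rewrite -[LHS]/(Im (expi (xi * x) * (sigma xi)%:C * fhat u xi)) fhatE// !ImM !ReM /= (mulrC xi) /sA /sS /A /S; ring.
Qed.

Lemma cbndsupp_multiplier_kernel x :
  cbndsupp (fun xi => expi (xi * x) * (sigma xi)%:C * fhat u xi).
Proof.
rewrite /cbndsupp -/(K x) ReK ImK.
by split; apply: bndsuppD; [exact: bndsupp_trigM|exact: bndsupp_trigM|exact: bndsupp_trigM|exact/bndsuppZ/bndsupp_trigM].
Qed.

(** With A and S the cosine and sine transforms of [u], this expands exp(i xi x) (A - i S). The
    output is thus again a combination of cosine and sine transforms, hence bounded and
    measurable. *)
Lemma multiplier1_ReE x : Re (multiplier1 sigma u x) = (2 * pi)^-1 * (ftrig true sA x + ftrig false sS x).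
Proof.
rewrite /multiplier1 ReM /= mul0r subr0; congr (_ * _).
rewrite -[LHS]/(\int[mu]_y (Re \o K x) y) ReK.
by rewrite bndsupp_RintegralD//; exact: bndsupp_trigM.
Qed.

Lemma multiplier1_ImE x : Im (multiplier1 sigma u x) = (2 * pi)^-1 * (ftrig false sA x - ftrig true sS x).
Proof.
rewrite /multiplier1 ImM /= mul0r addr0; congr (_ * _).
rewrite -[LHS]/(\int[mu]_y (Im \o K x) y) ImK.
rewrite bndsupp_RintegralD//; [|exact: bndsupp_trigM|exact/bndsuppZ/bndsupp_trigM].
by rewrite bndsupp_RintegralZ ?mulN1r//; exact: bndsupp_trigM.
Qed.

Lemma measurable_Re_multiplier1 : measurable_fun setT (Re \o multiplier1 sigma u).
Proof.
rewrite (_ : _ \o _ = fun x => (2 * pi)^-1 * (ftrig true sA x + ftrig false sS x)).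
  by apply: measurable_funM => //; apply: measurable_funD; exact: measurable_ftrig.
by apply/funext => x; exact: multiplier1_ReE.
Qed.

Lemma measurable_Im_multiplier1 : measurable_fun setT (Im \o multiplier1 sigma u).
Proof.
rewrite (_ : _ \o _ = fun x => (2 * pi)^-1 * (ftrig false sA x - ftrig true sS x)).
  by apply: measurable_funM => //; apply: measurable_funB; exact: measurable_ftrig.
by apply/funext => x; exact: multiplier1_ImE.
Qed.

Variable v : R -> R.
Hypothesis vn : bndsupp v.

Let nFv t h : bndsupp h -> bndsupp (fun x => ftrig t h x * v x).
Proof. by move=> hn; apply: (bndsuppM vn (measurable_ftrig t hn)) => x;
  exact: ftrig_bounded. Qed.

(** The duality [ftrig_pairing] moves the outer transform onto [v]. If [u] or [v] is even, one of
    the two integrals vanishes. *)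
Lemma Re_multiplier1_pairing : \int[mu]_x (Re (multiplier1 sigma u x) * v x) = (2 * pi)^-1 *
  (\int[mu]_xi (sigma xi * (A xi * ftrig true v xi)) + \int[mu]_xi (sigma xi * (S xi * ftrig false v xi))).
Proof.
have n1 := nFv true nsA; have n2 := nFv false nsS.
transitivity (\int[mu]_x ((2 * pi)^-1 * (ftrig true sA x * v x + ftrig false sS x * v x))).
  by apply: eq_Rintegral => x _; rewrite multiplier1_ReE -[LHS]mulrA; congr (_ * _);
    exact: mulrDl.
rewrite (bndsupp_RintegralZ _ (bndsuppD n1 n2)) (bndsupp_RintegralD n1 n2).
rewrite (ftrig_pairing true nsA vn) (ftrig_pairing false nsS vn).
by congr (_ * (_ + _)); apply: eq_Rintegral => x _; rewrite [LHS]mulrAC mulrC.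
Qed.

Lemma Im_multiplier1_pairing : \int[mu]_x (Im (multiplier1 sigma u x) * v x) = (2 * pi)^-1 *
  (\int[mu]_xi (sigma xi * (A xi * ftrig false v xi)) - \int[mu]_xi (sigma xi * (S xi * ftrig true v xi))).
Proof.
have n1 := nFv false nsA; have n2 := nFv true nsS; have n3 := bndsuppZ (-1) n2.
transitivity (\int[mu]_x ((2 * pi)^-1 * (ftrig false sA x * v x + -1 * (ftrig true sS x * v x)))).
  by apply: eq_Rintegral => x _; rewrite multiplier1_ImE -[LHS]mulrA mulN1r; congr (_ * _);
    exact: mulrBl.
rewrite (bndsupp_RintegralZ _ (bndsuppD n1 n3)) (bndsupp_RintegralD n1 n3) (bndsupp_RintegralZ _ n2).
rewrite (ftrig_pairing false nsA vn) (ftrig_pairing true nsS vn) mulN1r.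
by congr (_ * (_ - _)); apply: eq_Rintegral => x _; rewrite [LHS]mulrAC mulrC.
Qed.

End kernel.

Lemma Re_le_normc (z : R[i]) : `|Re z| <= normc z.
Proof. by case: z => a b /=; rewrite -sqrtr_sqr ler_wsqrtr// lerDl sqr_ge0. Qed.

Lemma Im_le_normc (z : R[i]) : `|Im z| <= normc z.
Proof. by case: z => a b /=; rewrite -sqrtr_sqr ler_wsqrtr// lerDr sqr_ge0. Qed.

Lemma measurable_normc d (T : measurableType d) (f : T -> R[i]) :
  measurable_fun setT (Re \o f) -> measurable_fun setT (Im \o f) ->
  measurable_fun setT (normc \o f).
Proof.
move=> mr mi.
rewrite (_ : normc \o f = @Num.sqrt R \o (fun x => Re (f x) ^+ 2 + Im (f x) ^+ 2)).
  apply: (@measurableT_comp _ _ _ _ _ _ (@Num.sqrt R)).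
    by apply: continuous_measurable_fun; exact: sqrt_continuous.
  by apply: measurable_funD; apply: (measurable_funX 2).
by apply/funext => x /=; case: (f x).
Qed.

Definition Lp1 (p : R) (f : R -> R) : \bar R := Lnorm mu p%:E (EFin \o f).

Lemma measurable_abse_poweR d (T : measurableType d) (p : R) (f : T -> R) :
  measurable_fun setT f -> measurable_fun setT (fun x => `|(EFin \o f) x| `^ p)%E.
Proof.
move=> mf; rewrite (_ : (fun x => _) = EFin \o (fun x => `|f x| `^ p)).
  apply/measurable_EFinP; apply: (measurableT_comp (@measurable_powR R p)).
  exact: measurableT_comp.
by [].
Qed.

Lemma le_poweR (x y : \bar R) (r : R) : (0 <= r)%R ->
  (0 <= x)%E -> (x <= y)%E -> (x `^ r <= y `^ r)%E.
Proof.
move=> r0 x0 xy; apply: gt0_ler_poweR => //.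
  by rewrite in_itv/= leey x0.
by rewrite in_itv/= leey (le_trans x0 xy).
Qed.

Lemma Lp1_bound (p K a : R) (f : R -> R) : 0 < p -> 0 <= K -> 0 < a ->
  measurable_fun setT f -> (forall x, `|f x| <= K) ->
  (forall x, a < `|x| -> f x = 0) ->
  (Lp1 p f <= (K * (a + a) `^ p^-1)%:E)%E.
Proof.
move=> p0 K0 a0 mf fK f0; rewrite /Lp1 unlock.
pose A : set R := `[- a, a]%classic.
have mA : measurable A by exact: measurable_itv.
have muA : mu A = (a + a)%:E.
  rewrite lebesgue_measure_itv/= lte_fin ifT; last by lra.
  by rewrite -EFinB opprK.
have H : (\int[mu]_x (`|(EFin \o f) x| `^ p) <= \int[mu]_(x in A) (K `^ p)%:E)%E.
  rewrite [leRHS]integral_mkcond; apply: ge0_le_integral => //.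
  - by move=> x _; exact: poweR_ge0.
  - exact: measurable_abse_poweR.
  - by apply/(measurable_restrictT _ mA); exact: measurable_cst.
  move=> x _; rewrite -[leLHS]/((`|f x| `^ p)%:E) patchE; case: ifPn => [_|xa].
    by rewrite lee_fin; apply: ge0_ler_powR; rewrite ?nnegrE//; exact: ltW.
  rewrite f0 ?normr0 ?powR0 ?gt_eqF// ltNge; apply: contra xa => xa.
  by apply/mem_set; rewrite /A/= in_itv/= -ler_norml.
rewrite integral_cst// in H.
have -> : ((K * (a + a) `^ p^-1)%:E = ((K `^ p)%:E * mu A) `^ p^-1)%E.
  rewrite muA -EFinM poweR_EFin powRM ?powR_ge0//; last by lra.
  by rewrite -powRrM mulfV ?gt_eqF// powRr1.
apply: le_poweR H; first by rewrite invr_ge0 ltW.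
by apply: integral_ge0 => x _; exact: poweR_ge0.
Qed.

Lemma Lp1_fin (p : R) (f : R -> R) : 0 < p -> bndsupp f -> (Lp1 p f < +oo)%E.
Proof.
move=> p0 fn; have [a [M [a0 M0 fM f0]]] := bndsupp_bound fn.
apply: le_lt_trans (ltry (M * (a + 1 + (a + 1)) `^ p^-1)).
apply: Lp1_bound => //; [lra|exact: bndsupp_measurable|].
by move=> x xa; apply: f0; lra.
Qed.

Lemma Lp1_scale (p w : R) (f : R -> R) : 0 < p -> 0 < w -> measurable_fun setT f ->
  Lp1 p (fun x => f (w * x)) = ((w^-1 `^ p^-1)%:E * Lp1 p f)%E.
Proof.
move=> p0 w0 mf; rewrite /Lp1 unlock.
have mfp := measurable_abse_poweR p mf.
have -> : (\int[mu]_x (`|(EFin \o (fun x => f (w * x))%R) x| `^ p) =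
    (w^-1)%:E * \int[mu]_x (`|(EFin \o f) x| `^ p))%E.
  rewrite -(ge0_integral_affine 0 w0 mfp (fun x => poweR_ge0 _ _)).
  by apply: eq_integral => x _; rewrite /= addr0.
rewrite poweRM//; first by rewrite lee_fin invr_ge0 ltW.
by apply: integral_ge0 => x _; exact: poweR_ge0.
Qed.

Lemma Rintegral_hoelder (p q : R) (f g : R -> R) :
  0 < p -> 0 < q -> p^-1 + q^-1 = 1 ->
  measurable_fun setT f -> measurable_fun setT g -> bndsupp (fun x => f x * g x) ->
  ((`|\int[mu]_x (f x * g x)|)%:E <= Lp1 p f * Lp1 q g)%E.
Proof.
move=> p0 q0 pq mf mg nfg; apply: le_trans (hoelder mu mf mg p0 q0 pq).
rewrite Lnorm1; have nn := bndsupp_norm nfg.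
apply: (@le_trans _ _ (\int[mu]_x `|f x * g x|)%:E).
  by rewrite lee_fin; exact: bndsupp_normr_Rintegral.
rewrite /Rintegral fineK//; apply: integrable_fin_num => //; exact: bndsupp_integrable.
Qed.

Lemma Lp1_le (p : R) (f g : R -> R) : 0 < p -> measurable_fun setT f ->
  measurable_fun setT g -> (forall x, `|f x| <= `|g x|) -> (Lp1 p f <= Lp1 p g)%E.
Proof.
move=> p0 mf mg fg; rewrite /Lp1 unlock.
apply: le_poweR; first by rewrite invr_ge0 ltW.
  by apply: integral_ge0 => x _; exact: poweR_ge0.
apply: ge0_le_integral => //.
- by move=> x _; exact: poweR_ge0.
- exact: measurable_abse_poweR.
- exact: measurable_abse_poweR.
by move=> x _; rewrite -[leLHS]/((`|f x| `^ p)%:E) -[leRHS]/((`|g x| `^ p)%:E) lee_fin;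
  apply: ge0_ler_powR; rewrite ?nnegrE//; exact: ltW.
Qed.

(** A real test function sees the real and the imaginary part separately, and each is dominated by
    the modulus of the output. The sup bounds supplied in the proof ensure that the products with
    [v] are integrable. *)
Lemma multiplier1_hoelder (p q : R) (sigma u v : R -> R) :
  0 < p -> 0 < q -> p^-1 + q^-1 = 1 -> bndsupp sigma -> bndsupp u -> bndsupp v ->
  ((`|\int[mu]_x (Re (multiplier1 sigma u x) * v x)|)%:E <=
     Lp1 p (normc \o multiplier1 sigma u) * Lp1 q v)%E /\
  ((`|\int[mu]_x (Im (multiplier1 sigma u x) * v x)|)%:E <=
     Lp1 p (normc \o multiplier1 sigma u) * Lp1 q v)%E.
Proof.
move=> p0 q0 pq sn un vn.
have mR := measurable_Re_multiplier1 sn un; have mI := measurable_Im_multiplier1 sn un.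
have mN := measurable_normc mR mI.
have H (X : R -> R) (K : R) : measurable_fun setT X -> (forall x, `|X x| <= K) ->
    (forall x, `|X x| <= normc (multiplier1 sigma u x)) ->
    ((`|\int[mu]_x (X x * v x)|)%:E <= Lp1 p (normc \o multiplier1 sigma u) * Lp1 q v)%E.
  move=> mX XK XN; have nX := bndsuppM vn mX XK.
  apply: le_trans (Rintegral_hoelder p0 q0 pq mX (bndsupp_measurable vn) nX) _.
  apply: lee_wpmul2r; first exact: Lnorm_ge0.
  by apply: Lp1_le => // x; rewrite /= [leRHS]ger0_norm// (le_trans _ (XN x)).
have pi2 : 0 <= (2 * pi)^-1 :> R by rewrite invr_ge0 mulr_ge0// pi_ge0.
have nsF t : bndsupp (fun xi => ftrig t u xi * sigma xi).
  by apply: (bndsuppM sn (measurable_ftrig t un)) => x; exact: ftrig_bounded.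
split.
- apply: (H _ ((2 * pi)^-1 * (\int[mu]_y `|ftrig true u y * sigma y| + \int[mu]_y `|ftrig false u y * sigma y|)) mR).
    move=> x; rewrite -[X in `|X|]/(Re (multiplier1 sigma u x)) multiplier1_ReE// normrM (ger0_norm pi2) ler_wpM2l//.
    by apply: le_trans (ler_normD _ _) _; apply: lerD; exact: ftrig_bounded.
  by move=> x; exact: Re_le_normc.
- apply: (H _ ((2 * pi)^-1 * (\int[mu]_y `|ftrig true u y * sigma y| + \int[mu]_y `|ftrig false u y * sigma y|)) mI).
    move=> x; rewrite -[X in `|X|]/(Im (multiplier1 sigma u x)) multiplier1_ImE// normrM (ger0_norm pi2) ler_wpM2l//.
    by apply: le_trans (ler_normB _ _) _; apply: lerD; exact: ftrig_bounded.
  by move=> x; exact: Im_le_normc.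
Qed.

End one_dimensional_operator.

(** * The operator norm on the line *)

Section one_dimensional_bound.
Context {R : realType}.
Local Open Scope classical_set_scope.
Local Open Scope complex_scope.
Local Open Scope ring_scope.
Local Notation mu := (@lebesgue_measure R).
Local Notation Re := (@complex.Re R).
Local Notation Im := (@complex.Im R).
Local Notation normc := (@normc R).
Local Notation B := (@bump_mass R)^-1.
Variable m : nat.
Let N : R := (2 ^ m)%:R.
Let N1 : 1 <= N. Proof. by rewrite ler1n expn_gt0. Qed.
Let N0 : 0 < N. Proof. exact: lt_le_trans N1. Qed.
Let B0 : 0 < B. Proof. by rewrite invr_gt0; exact: bump_mass_gt0. Qed.

Lemma Lp1_conc_le (s : R) : 0 < s ->
  (Lp1 s (conc m) <= (N * B * (2 / N) `^ s^-1)%:E)%E.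
Proof.
move=> s0; have -> : 2 / N = N^-1 + N^-1 by rewrite mulr_natl mulr2n.
apply: Lp1_bound => //.
- by rewrite mulr_ge0 ?ltW.
- by rewrite invr_gt0.
- by apply: bndsupp_measurable; exact: bndsupp_conc.
- by move=> x; rewrite /conc normrM ger0_norm// ler_pM2l//; exact: bump_le.
- exact: conc_supp.
Qed.

Lemma Lp1_wave_le (s : R) q t : 0 < s ->
  (Lp1 s (wave m q t) <= (Num.sqrt (2 * N) * B * 2 `^ s^-1)%:E)%E.
Proof.
move=> s0; have -> : 2 = 1 + 1 :> R by [].
apply: Lp1_bound => //.
- by rewrite mulr_ge0 ?sqrtr_ge0 ?ltW.
- by apply: bndsupp_measurable; exact: bndsupp_wave.
- by move=> x; rewrite /wave normrM; apply: ler_pM => //; [exact: rs_sum_le|exact: bump_le].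
- exact: wave_supp.
Qed.

(** The powers of N combine to 1 - 1/r + 1/2. The constant is 2^(1/r + 1/r') sqrt 2 = 2 sqrt 2,
    rounded up to 4. *)
Lemma conc_wave_norms (r r' : R) : 0 < r -> 0 < r' -> r^-1 + r'^-1 = 1 ->
  (N * B * (2 / N) `^ r^-1) * (Num.sqrt (2 * N) * B * 2 `^ r'^-1) <=
  4 * B ^+ 2 * (N / N `^ (r^-1 - 2^-1)).
Proof.
move=> r0 r'0 rr'.
have EN : N `^ (r^-1 - 2^-1) = N `^ r^-1 / Num.sqrt N.
  rewrite powRB; last by rewrite (gt_eqF N0) implybT.
  by rewrite powR12_sqrt// ltW.
have N0' := ltW N0.
have -> : (2 / N) `^ r^-1 = 2 `^ r^-1 * (N `^ r^-1)^-1.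
  by rewrite powRM ?invr_ge0//; congr (_ * _); rewrite -(powR_inv1 N0') -powRrM mulN1r powRN.
rewrite EN sqrtrM//.
have E2 : 2 `^ r^-1 * 2 `^ r'^-1 = 2 :> R.
  by rewrite -powRD ?rr' ?powRr1//; apply/implyP.
have s2 : Num.sqrt 2 <= 2 :> R.
  by rewrite -[leRHS]ger0_norm// -sqrtr_sqr ler_wsqrtr//; lra.
have Nr0 : 0 < N `^ r^-1 by rewrite powR_gt0.
have sN : 0 < Num.sqrt N by rewrite sqrtr_gt0.
rewrite [leLHS](_ : _ = (2 `^ r^-1 * 2 `^ r'^-1) * Num.sqrt 2 * (B ^+ 2 * (N * (N `^ r^-1)^-1 * Num.sqrt N))).
  rewrite E2 [leRHS](_ : _ = 4 * (B ^+ 2 * (N * (N `^ r^-1)^-1 * Num.sqrt N))).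
    apply: ler_wpM2r; last by lra.
    by rewrite mulr_ge0 ?sqr_ge0// !mulr_ge0 ?invr_ge0 ?ltW.
  by rewrite invf_div; ring.
by ring.
Qed.

(** Divide Hoelder's inequality d N <= nT nv by V and compare with U. Only the norms appear, since
    [conc] and [wave] exchange the roles of input and test function; [nT] may be infinite. *)
Lemma lower_bound_of_pairing (d r : R) (U V : R) (nu nv nT : \bar R) :
  0 < d -> 0 < V -> (0 <= nT)%E -> (nu <= U%:E)%E -> (nv <= V%:E)%E -> (0 <= nv)%E ->
  U * V <= 4 * B ^+ 2 * (N / N `^ (r^-1 - 2^-1)) ->
  ((d * N)%:E <= nT * nv)%E ->
  ((B ^- 2 / 4 * d * N `^ (r^-1 - 2^-1))%:E * nu <= nT)%E.
Proof.
move=> d0 V0 T0 nU nV v0 UV H.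
set g := N `^ _; have g0 : 0 < g by rewrite powR_gt0.
have B2 : 0 < B ^- 2 by rewrite invr_gt0 exprn_gt0.
have c0 : 0 < B ^- 2 / 4 * d * g.
  by apply: mulr_gt0 => //; apply: mulr_gt0 => //; apply: divr_gt0.
apply: (@le_trans _ _ ((B ^- 2 / 4 * d * g)%:E * U%:E)%E).
  by apply: lee_wpmul2l => //; rewrite lee_fin ltW.
move: T0 H; case: nT => [t||] // t0 H; last by rewrite leey.
have {}H : d * N <= t * V.
  rewrite -lee_fin EFinM; apply: le_trans H _.
  by rewrite EFinM; apply: lee_wpmul2l.
rewrite -EFinM lee_fin -(ler_pM2r V0); apply: le_trans H.
rewrite -mulrA; apply: (@le_trans _ _ (B ^- 2 / 4 * d * g * (4 * B ^+ 2 * (N / g)))).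
  by apply: ler_wpM2l => //; exact: ltW.
rewrite le_eqVlt; apply/orP; left; apply/eqP.
have b0 : bump_mass != 0 :> R by apply: lt0r_neq0; exact: bump_mass_gt0.
by clear c0; move: (bump_mass) b0 (g) g0 => b b0 g' g0'; field; rewrite b0 gt_eqF.
Qed.

Lemma measurable_multiplier1_norm sigma u : bndsupp sigma -> bndsupp u ->
  measurable_fun setT (normc \o multiplier1 sigma u).
Proof.
by move=> sn un; apply: measurable_normc;
  [exact: measurable_Re_multiplier1|exact: measurable_Im_multiplier1].
Qed.

(** By Hoelder's inequality a vanishing norm would force the pairing with [g] to vanish. *)
Lemma Lp1_gt0 (p : R) (u g : R -> R) : 1 < p -> bndsupp u -> measurable_fun setT g ->
  bndsupp (fun x => u x * g x) -> \int[mu]_x (u x * g x) != 0 -> (0 < Lp1 p u)%E.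
Proof.
move=> p1 un mg ng nz; rewrite lt0e Lnorm_ge0 andbT; apply/eqP => u0.
have p0 : 0 < p := lt_trans ltr01 p1.
have q0 : 0 < (1 - p^-1)^-1 by rewrite invr_gt0 subr_gt0 invf_lt1.
have pq : p^-1 + (1 - p^-1)^-1^-1 = 1 by rewrite invrK; lra.
have := Rintegral_hoelder p0 q0 pq (bndsupp_measurable un) mg ng.
by rewrite u0 mul0e lee_fin normr_le0 (negbTE nz).
Qed.

Lemma one_dimensional_bound (p : R) : 1 < p -> exists q u,
  [/\ smooth1 u, exists a : R, forall x, a < `|x| -> u x = 0,
    (0 < Lp1 p u)%E &
    ((B ^- 2 / 4 * ((2 * pi)^-1 / 128) * N `^ `|p^-1 - 2^-1|)%:E * Lp1 p u <=
      Lp1 p (normc \o multiplier1 (symb m q) u))%E].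
Proof.
move=> p1; have p0 : 0 < p := lt_trans ltr01 p1.
pose p' := (1 - p^-1)^-1.
have p'0 : 0 < p' by rewrite invr_gt0 subr_gt0 invf_lt1.
have pq : p^-1 + p'^-1 = 1 by rewrite invrK; lra.
have [q [t HI]] := @rs_sum_mass R m.
have HP := pairing_ge HI.
have nc := bndsupp_conc (R := R) m; have nw := bndsupp_wave (R := R) m q t.
have ns := bndsupp_symb (R := R) m q.
have S0 xi : ftrig false (conc m) xi = 0 :> R by apply: ftrig_sin_even => // x; exact: concN.
have pi0 : 0 < pi :> R by exact: pi_gt0.
have P0 : 0 <= (2 * pi)^-1 :> R by rewrite invr_ge0 mulr_ge0// ltW.
set I := \int[mu]_xi _ in HP.
have P1 : 0 < (2 * pi)^-1 / 128 :> R.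
  by apply: divr_gt0 => //; rewrite invr_gt0; apply: mulr_gt0.
have HN : (2 * pi)^-1 / 128 * N <= (2 * pi)^-1 * I.
  rewrite -[leLHS]mulrA; apply: ler_wpM2l => //.
  by rewrite mulrC.
have zint (f g : R -> R) : (forall xi, f xi = 0) -> \int[mu]_xi (symb m q xi * (f xi * g xi)) = 0.
  move=> f0; under eq_Rintegral do rewrite f0 mul0r mulr0.
  by rewrite Rintegral_cst// mul0r.
have HN' : (((2 * pi)^-1 / 128 * N)%:E <= (`|(2 * pi)^-1 * I|)%:E)%E.
  by rewrite lee_fin (le_trans HN)// ler_norm.
have V1 s : 0 < N * B * (2 / N) `^ s by rewrite !mulr_gt0 ?powR_gt0// divr_gt0.
have V2 s : 0 < Num.sqrt (2 * N) * B * 2 `^ s.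
  by rewrite !mulr_gt0 ?powR_gt0// sqrtr_gt0 mulr_gt0.
exists q; have [p2|p2] := leP p 2.
- exists (conc m); split.
  + exact: smooth1_conc.
  + by exists N^-1; exact: conc_supp.
  + apply: (Lp1_gt0 (g := cst 1)) => //.
      by rewrite (_ : (fun x => _) = conc m)//; apply/funext => x; rewrite mulr1.
    under eq_Rintegral do rewrite mulr1.
    by rewrite Rintegral_conc oner_neq0.
  rewrite ger0_norm; last by rewrite subr_ge0 lef_pV2// posrE.
  apply: (lower_bound_of_pairing P1 (V2 p'^-1) _ (Lp1_conc_le p0) (Lp1_wave_le q t p'0)).
  + exact: Lnorm_ge0.
  + exact: Lnorm_ge0.
  + exact: conc_wave_norms.
  apply: le_trans HN' _.
  have [HR HIm] := multiplier1_hoelder p0 p'0 pq ns nc nw.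
  (* Only the cosine transform of [conc] survives; it meets the cosine transform of [wave] in the
     real part and the sine transform in the imaginary part. *)
  rewrite /I; case: (t) nw HR HIm HI => nw HR HIm HI.
  + by move: HR; rewrite (Re_multiplier1_pairing ns nc nw) (zint (ftrig false (conc m)) _ S0) addr0.
  + by move: HIm; rewrite (Im_multiplier1_pairing ns nc nw) (zint (ftrig false (conc m)) _ S0) subr0.
exists (wave m q t); split.
- exact: smooth1_wave.
- by exists 1; exact: wave_supp.
- have ng : bndsupp (fun x : R => wave m q t x * rs_sum m q t x).
    rewrite (_ : (fun x => _) = (fun x => rs_sum m q t x * wave m q t x)).
      by apply: (bndsuppM nw (measurable_rs_sum m q t)) => x; exact: rs_sum_le.
    by apply/funext => x; rewrite mulrC.
  apply: (Lp1_gt0 p1 nw (measurable_rs_sum m q t) ng).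
  apply/eqP => E; move: HI.
  have -> : \int[mu]_x (bump x * rs_sum m q t x ^+ 2) =
      \int[mu]_x (wave m q t x * rs_sum m q t x).
    by apply: eq_Rintegral => x _; rewrite /wave; ring.
  by rewrite E leNgt divr_gt0.
(* For p > 2 the exponent 1/2 - 1/p is 1/p' - 1/2, so the previous estimate applies with p and p'
   exchanged. *)
have -> : `|p^-1 - 2^-1| = p'^-1 - 2^-1.
  rewrite ltr0_norm; first by rewrite invrK; lra.
  by rewrite subr_lt0 ltf_pV2// posrE.
have qp : p'^-1 + p^-1 = 1 by rewrite addrC.
apply: (lower_bound_of_pairing P1 (V1 p'^-1) _ (Lp1_wave_le q t p0) (Lp1_conc_le p'0)).
- exact: Lnorm_ge0.
- exact: Lnorm_ge0.
- by rewrite mulrC; exact: conc_wave_norms.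
apply: le_trans HN' _.
have [HR HIm] := multiplier1_hoelder p0 p'0 pq ns nw nc.
have swap (f : R -> R) : \int[mu]_xi (symb m q xi * (f xi * ftrig true (conc m) xi)) =
    \int[mu]_xi (symb m q xi * (ftrig true (conc m) xi * f xi)).
  by apply: eq_Rintegral => xi _; congr (_ * _); exact: mulrC.
have zint' (f : R -> R) : \int[mu]_xi (symb m q xi * (f xi * ftrig false (conc m) xi)) = 0.
  under eq_Rintegral do rewrite S0 !mulr0.
  by rewrite Rintegral_cst// mul0r.
rewrite /I; case: (t) nw HR HIm HI => nw HR HIm HI.
- move: HR.
  rewrite (Re_multiplier1_pairing ns nw nc).
  rewrite zint'.
  rewrite addr0 (swap (ftrig true (wave m q true))).
  by apply.
- move: HIm; rewrite (Im_multiplier1_pairing ns nw nc) zint' sub0r mulrN normrN (swap (ftrig false (wave m q false))).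
  by apply.
Qed.

End one_dimensional_bound.

(** * Tensor products *)

Section tensor_integrals.
Context {R : realType}.
Local Open Scope classical_set_scope.
Local Open Scope complex_scope.
Local Open Scope ring_scope.
Local Notation mR := (measurableTypeR R).
Local Notation mu1 := (@lebesgue_measure R).
Local Notation mu n := (lebesgue_rV n : {measure set 'rV[R]_n -> \bar R}).
Local Notation Re := (@complex.Re R).
Local Notation Im := (@complex.Im R).

Definition box (n : nat) (a : R) : set 'rV[R]_n := [set x | forall i, `|x 0 i| <= a].
Arguments box : clear implicits.

Lemma boxE (n : nat) (a : R) : box n a = [set x | forall i, [set` `[- a, a]%R] (x 0 i)].
Proof.
by apply/seteqP; split=> x Hx i; have := Hx i; rewrite /= in_itv/= -ler_norml.
Qed.

Lemma measurable_box (n : nat) (a : R) : measurable (box n a).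
Proof.
have -> : box n a = \bigcap_(i in [set: 'I_n]) ((fun v : 'rV[R]_n => v 0 i : mR) @^-1` [set` `[- a, a]%R]).
  by rewrite boxE; apply/seteqP; split => v /= H i; [move=> _; exact: H|exact: (H i I)].
apply: fin_bigcap_measurable => // i _; rewrite -[X in measurable X]setTI.
by apply: (measurable_rV_coord i) => //; exact: measurable_itv.
Qed.

Lemma lebesgue_rV_boxE (n : nat) (a : R) : 0 <= a -> mu n (box n a) = ((a + a) ^+ n)%:E.
Proof.
move=> a0; rewrite boxE (lebesgue_rV_box (A := fun=> [set` `[- a, a]%R])); last first.
  by move=> i; exact: measurable_itv.
have -> : mu1 [set` `[- a, a]%R] = (a + a)%:E.
  rewrite lebesgue_measure_itv/= lte_fin; case: ifPn => [_|]; first by rewrite -EFinB opprK.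
  by rewrite -leNgt => H; congr EFin; lra.
by rewrite -[X in (_ ^+ X)%:E]card_ord -prodr_const prodEFin.
Qed.

Lemma lebesgue_rV_sigma_finite n : sigma_finite setT (mu n).
Proof.
exists (fun k : nat => box n k%:R) => [|k].
  apply/seteqP; split=> // x _.
  exists (Num.bound (\sum_i `|x 0 i|)) => // i /=.
  apply: le_trans (ltW (archi_boundP _)); last by apply: sumr_ge0.
  by rewrite (bigD1 i)//= lerDl sumr_ge0.
split; first exact: measurable_box.
by rewrite lebesgue_rV_boxE// ltry.
Qed.

(* A sigma-finite copy of [lebesgue_rV n], as required by the Fubini theorems. *)
Definition lebesgue_sf (n : nat) : set 'rV[R]_n -> \bar R := mu n.
Arguments lebesgue_sf n : clear implicits.
HB.instance Definition _ n := Measure.on (lebesgue_sf n).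
HB.instance Definition _ n := @Measure_isSigmaFinite.Build _ _ _
  (lebesgue_sf n) (lebesgue_rV_sigma_finite n).

Local Notation cons := (@rV_cons R _).

(** Since [lebesgue_rV] is built one coordinate at a time as the image of a product measure,
    Tonelli's theorem becomes a recursion on the dimension. *)
Lemma ge0_integral_rV_cons n (f : 'rV[R]_n.+1 -> \bar R) :
  measurable_fun setT f -> (forall x, (0 <= f x)%E) ->
  (\int[mu n.+1]_x f x = \int[mu n]_v \int[mu1]_t f (cons (v, t)))%E.
Proof.
move=> mf f0.
have mfc := measurableT_comp mf (@measurable_rV_cons R n).
transitivity (\int[lebesgue_sf n \x mu1]_z (f \o (@rV_cons R n)) z)%E.
  rewrite -[RHS](@ge0_integral_pushforward _ _ _ _ _ _ (@measurable_rV_cons R n) _ setT f)//.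
by rewrite (fubini_tonelli1 (f \o (@rV_cons R n))) => // z; exact: f0.
Qed.

Lemma integral_rV_cons n (f : 'rV[R]_n.+1 -> R) :
  (mu n.+1).-integrable setT (EFin \o f) ->
  (\int[mu n.+1]_x (f x)%:E = \int[mu n]_v \int[mu1]_t (f (cons (v, t)))%:E)%E.
Proof.
move=> fi; have mf := measurable_int _ fi.
have mfc := measurableT_comp mf (@measurable_rV_cons R n).
have fci : (lebesgue_sf n \x mu1)%E.-integrable setT (EFin \o f \o (@rV_cons R n)).
  apply/integrable12ltyP => //; have /integrableP[_] := fi.
  rewrite ge0_integral_rV_cons//; last exact: measurableT_comp.
transitivity (\int[lebesgue_sf n \x mu1]_z (EFin \o f \o (@rV_cons R n)) z)%E.
  by rewrite -[RHS](@integral_pushforward _ _ _ _ _ _ (@measurable_rV_cons R n) _ setT (EFin \o f)).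
by rewrite -integral12_prod_meas1.
Qed.

Definition bndsupp_rV n (g : 'rV[R]_n -> R) := measurable_fun setT g /\
  exists a M : R, forall x, `|g x| <= M /\ (~ box n a x -> g x = 0).

Lemma bndsupp_rV_integrable n (g : 'rV[R]_n -> R) : bndsupp_rV g ->
  (mu n).-integrable setT (EFin \o g).
Proof.
move=> [mg [a0 [M H]]]; pose a := Num.max a0 0.
have aa : 0 <= a by rewrite le_max lexx orbT.
have g0 x : ~ box n a x -> g x = 0.
  move=> nb; apply (H x).2 => b; apply: nb => i; apply: le_trans (b i) _.
  by rewrite le_max lexx.
have mb := @measurable_box n a.
have M0 : 0 <= M := le_trans (normr_ge0 _) (H 0).1.
apply/integrableP; split; first exact/measurable_EFinP.
have K : (\int[mu n]_x `|(EFin \o g) x| <= \int[mu n]_(x in box n a) M%:E)%E.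
  rewrite [leRHS]integral_mkcond; apply: ge0_le_integral => //.
  - by apply: measurableT_comp => //; exact/measurable_EFinP.
  - by apply/(measurable_restrictT _ mb); exact: measurable_cst.
  move=> x _; rewrite patchE; case: ifPn => [_|xa]; first by rewrite /= lee_fin (H x).1.
  rewrite /= g0 ?normr0// => bx; move: xa; by rewrite mem_set.
apply: (le_lt_trans K).
by rewrite integral_cst//= lebesgue_rV_boxE// -EFinM ltry.
Qed.

Definition tail n (x : 'rV[R]_n.+1) : 'rV[R]_n := \row_j x 0 (lift ord0 j).

Lemma head_cons n (v : 'rV[R]_n) t : cons (v, t) 0 ord0 = t.
Proof.
have -> : ord0 = lshift n ord0 :> 'I_(1 + n) by exact/val_inj.
by rewrite [rV_cons _ 0 _](row_mxEl t%:M v) mxE eqxx mulr1n.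
Qed.

Lemma tail_cons n (v : 'rV[R]_n) t : tail (cons (v, t)) = v.
Proof.
apply/rowP => j; rewrite mxE.
have -> : lift ord0 j = rshift 1 j :> 'I_(1 + n) by exact/val_inj.
exact: (row_mxEr t%:M v).
Qed.

Lemma measurable_head n :
  measurable_fun [set: 'rV[R]_n.+1] (fun x => x 0 ord0 : mR).
Proof. exact: measurable_rV_coord. Qed.

Lemma measurable_tail n : measurable_fun [set: 'rV[R]_n.+1] (@tail n).
Proof.
apply/measurable_fun_rVP => i; under eq_fun do rewrite mxE.
exact: measurable_rV_coord.
Qed.

Lemma bndsupp_rV_head_tail n (h : R -> R) (G : 'rV[R]_n -> R) : bndsupp h -> bndsupp_rV G ->
  bndsupp_rV (fun x => h (x 0 ord0) * G (tail x)).
Proof.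
move=> hn [mG [b [M' HG]]]; have [a [M [_ M0 hM h0]]] := bndsupp_bound hn.
split.
  apply: measurable_funM; first exact: (measurableT_comp (bndsupp_measurable hn) (@measurable_head n)).
  exact: (measurableT_comp mG (@measurable_tail n)).
exists (Num.max a b), (M * M') => x; split.
  by rewrite normrM ler_pM// (HG _).1.
move=> nb; have [xa|xa] := leP `|x 0 ord0| a; last by rewrite h0 ?mul0r.
rewrite (HG (tail x)).2 ?mulr0// => bx; apply: nb => i.
rewrite le_max; case: (unliftP ord0 i) => [j|] ->; last by rewrite xa.
by have := bx j; rewrite mxE => ->; rewrite orbT.
Qed.

Lemma Rintegral_head_tail n (h : R -> R) (G : 'rV[R]_n -> R) : bndsupp h -> bndsupp_rV G ->
  \int[mu n.+1]_x (h (x 0 ord0) * G (tail x)) =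
  (\int[mu1]_t h t) * \int[mu n]_v G v.
Proof.
move=> hn Gn; have fi := bndsupp_rV_integrable (bndsupp_rV_head_tail hn Gn).
have hi := bndsupp_integrable hn; have Gi := bndsupp_rV_integrable Gn.
rewrite /Rintegral integral_rV_cons//.
transitivity (fine (\int[mu n]_v ((\int[mu1]_t (h t)%:E) * (G v)%:E))%E).
  congr fine; apply: eq_integral => v _.
  under eq_integral do rewrite head_cons tail_cons mulrC EFinM.
  by rewrite integralZl// muleC.
have hf : (\int[mu1]_t (h t)%:E)%E \is a fin_num by exact: integrable_fin_num.
rewrite -(fineK hf) integralZl// fineM//; exact: integrable_fin_num.
Qed.

Lemma bndsupp_rVB n (F G : 'rV[R]_n -> R) : bndsupp_rV F -> bndsupp_rV G ->
  bndsupp_rV (fun x => F x - G x).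
Proof.
move=> [mF [a [M HF]]] [mG [b [M' HG]]]; split; first exact: measurable_funB.
exists (Num.max a b), (M + M') => x; split.
  by rewrite (le_trans (ler_normB _ _))// lerD ?(HF x).1 ?(HG x).1.
move=> nb; rewrite (HF x).2 ?(HG x).2 ?subr0// => bx; apply: nb => i.
  by rewrite le_max (bx i) orbT.
by rewrite le_max (bx i).
Qed.

Lemma bndsupp_rVD n (F G : 'rV[R]_n -> R) : bndsupp_rV F -> bndsupp_rV G ->
  bndsupp_rV (fun x => F x + G x).
Proof.
move=> [mF [a [M HF]]] [mG [b [M' HG]]]; split; first exact: measurable_funD.
exists (Num.max a b), (M + M') => x; split.
  by rewrite (le_trans (ler_normD _ _))// lerD ?(HF x).1 ?(HG x).1.
move=> nb; rewrite (HF x).2 ?(HG x).2 ?addr0// => bx; apply: nb => i.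
  by rewrite le_max (bx i) orbT.
by rewrite le_max (bx i).
Qed.

Definition cbndsupp_rV n (F : 'rV[R]_n -> R[i]) := bndsupp_rV (Re \o F) /\ bndsupp_rV (Im \o F).

(** Bounded support is carried along the induction: a complex product splits into four real ones,
    whose integrals can be added only once they are known to converge. *)
Lemma cintegral_tensor_aux n (f : 'I_n -> R -> R[i]) : (forall i, cbndsupp (f i)) ->
  cbndsupp_rV (fun x : 'rV[R]_n => \prod_i f i (x 0 i)) /\
  cintegral (fun x : 'rV[R]_n => \prod_i f i (x 0 i)) = \prod_i cintegral1 (f i).
Proof.
elim: n f => [|n IH] f fn.
  have cst1 : (fun x : 'rV[R]_0 => \prod_i f i (x 0 i)) = fun=> 1.
    by apply/funext => x; rewrite big_ord0.
  rewrite cst1 big_ord0; split.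
    split; split; first exact: measurable_cst.
    - by exists 0, 1 => x; split; [rewrite normr1|case; case].
    - exact: measurable_cst.
    - by exists 0, 0 => x; split; [rewrite normr0|].
  rewrite /cintegral /Rintegral !integral_dirac//.
  by rewrite !diracT !mul1e.
have [[nRe nIm] E] := IH (fun i => f (lift ord0 i)) (fun i => fn (lift ord0 i)).
set P := (fun x : 'rV[R]_n => _) in nRe nIm E.
have [n0R n0I] := fn ord0.
have PE : (fun x : 'rV[R]_n.+1 => \prod_i f i (x 0 i)) =
    fun x => f ord0 (x 0 ord0) * P (tail x).
  apply/funext => x; rewrite big_ord_recl; congr (_ * _).
  by apply: eq_bigr => i _; rewrite mxE.
have nRR := bndsupp_rV_head_tail n0R nRe; have nII := bndsupp_rV_head_tail n0I nIm.
have nRI := bndsupp_rV_head_tail n0R nIm; have nIR := bndsupp_rV_head_tail n0I nRe.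
have ReE : Re \o (fun x : 'rV[R]_n.+1 => f ord0 (x 0 ord0) * P (tail x)) =
    fun x => (Re \o f ord0) (x 0 ord0) * (Re \o P) (tail x) -
      (Im \o f ord0) (x 0 ord0) * (Im \o P) (tail x).
  by apply/funext => x; rewrite [LHS]ReM.
have ImE : Im \o (fun x : 'rV[R]_n.+1 => f ord0 (x 0 ord0) * P (tail x)) =
    fun x => (Re \o f ord0) (x 0 ord0) * (Im \o P) (tail x) +
      (Im \o f ord0) (x 0 ord0) * (Re \o P) (tail x).
  by apply/funext => x; rewrite [LHS]ImM.
rewrite PE; split.
  by rewrite /cbndsupp_rV ReE ImE; split; [exact: bndsupp_rVB|exact: bndsupp_rVD].
rewrite big_ord_recl -E.
transitivity ((\int[mu n.+1]_x (Re \o (fun x : 'rV[R]_n.+1 => f ord0 (x 0 ord0) * P (tail x))) x) +i*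
  (\int[mu n.+1]_x (Im \o (fun x : 'rV[R]_n.+1 => f ord0 (x 0 ord0) * P (tail x))) x));
    first by [].
rewrite ReE ImE RintegralB//; try exact: bndsupp_rV_integrable.
rewrite RintegralD//; try exact: bndsupp_rV_integrable.
by rewrite !Rintegral_head_tail.
Qed.

Lemma cintegral_tensor n (f : 'I_n -> R -> R[i]) : (forall i, cbndsupp (f i)) ->
  cintegral (fun x : 'rV[R]_n => \prod_i f i (x 0 i)) = \prod_i cintegral1 (f i).
Proof. by move=> /cintegral_tensor_aux[]. Qed.

Lemma integral_tensor n (f : 'I_n -> R -> \bar R) :
  (forall i, measurable_fun setT (f i)) -> (forall i x, (0 <= f i x)%E) ->
  measurable_fun setT (fun x : 'rV[R]_n => \prod_i f i (x 0%R i))%E /\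
  (\int[mu n]_x \prod_i f i (x 0%R i) = \prod_i \int[mu1]_t f i t)%E.
Proof.
elim: n f => [|n IH] f mf f0.
  have cst1 : (fun x : 'rV[R]_0 => \prod_i f i (x 0%R i))%E = fun=> 1%E.
    by apply/funext => x; rewrite big_ord0.
  rewrite cst1 big_ord0; split; first exact: measurable_cst.
  by rewrite integral_dirac// diracT mul1e.
have [mP E] := IH (fun i => f (lift ord0 i)) (fun i => mf _) (fun i => f0 _).
set P := (fun x : 'rV[R]_n => _) in mP E.
have P0 v : (0 <= P v)%E by apply: prode_ge0 => i _; exact: f0.
have PE : (fun x : 'rV[R]_n.+1 => \prod_i f i (x 0%R i))%E =
    fun x => (f ord0 (x 0%R ord0) * P (tail x))%E.
  apply/funext => x; rewrite big_ord_recl; congr (_ * _)%E.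
  by apply: eq_bigr => i _; rewrite mxE.
have mPE : measurable_fun setT (fun x : 'rV[R]_n.+1 => f ord0 (x 0%R ord0) * P (tail x))%E.
  apply: emeasurable_funM; first exact: (measurableT_comp (mf ord0) (@measurable_head n)).
  exact: (measurableT_comp mP (@measurable_tail n)).
rewrite PE; split=> //.
rewrite ge0_integral_rV_cons//; last by move=> x; exact: mule_ge0.
rewrite big_ord_recl -E -ge0_integralZl//; last exact: integral_ge0.
  apply: eq_integral => v _; under eq_integral do rewrite head_cons tail_cons.
  by rewrite ge0_integralZr//; exact: mf.
by move=> x _; exact: P0.
Qed.

Lemma poweR_prod n (a : 'I_n -> \bar R) (r : R) : (forall i, (0 <= a i)%E) ->
  ((\prod_i a i) `^ r = \prod_i (a i `^ r))%E.
Proof.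
elim: n a => [|n IH] a a0; first by rewrite !big_ord0 poweR1r.
by rewrite !big_ord_recl poweRM ?IH//; apply: prode_ge0 => i _; exact: a0.
Qed.

Lemma normc_prod n (z : 'I_n -> R[i]) :
  @normc R (\prod_i z i) = \prod_i @normc R (z i).
Proof.
elim: n z => [|n IH] z; first by rewrite !big_ord0 normc1.
by rewrite !big_ord_recl normcM IH.
Qed.

Lemma prode_abse n (a : 'I_n -> \bar R) : (`|\prod_i a i| = \prod_i `|a i|)%E.
Proof.
elim: n a => [|n IH] a; first by rewrite !big_ord0 abse1.
by rewrite !big_ord_recl abseM IH.
Qed.

Lemma Lp_norm_tensor n (p : R) (f : 'I_n -> R -> R[i]) :
  (forall i, measurable_fun setT (@normc R \o f i)) ->
  Lp_norm p (fun x : 'rV[R]_n => \prod_i f i (x 0 i)) =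
  (\prod_i Lp1 p (@normc R \o f i))%E.
Proof.
move=> mf; rewrite /Lp_norm /Lp1 unlock.
have Hi i := measurable_abse_poweR p (mf i).
have [_ E] := integral_tensor Hi (fun i x => poweR_ge0 _ _).
rewrite -poweR_prod; last by move=> i; apply: integral_ge0 => x _; exact: poweR_ge0.
rewrite -E; congr (_ `^ _)%E; apply: eq_integral => x _.
rewrite -poweR_prod; last by move=> i; exact: abse_ge0.
rewrite -(@prode_abse n (fun i => ((@normc R \o f i) (x 0 i))%:E)) prodEFin;
  congr (`|_%:E| `^ _)%E.
exact: normc_prod.
Qed.

End tensor_integrals.

(** * Derivatives of tensor products *)

Section tensor_smoothness.
Context {R : realType} (n : nat).
Local Open Scope classical_set_scope.
Local Open Scope complex_scope.
Local Open Scope ring_scope.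
Implicit Types (h : 'I_n -> R -> R) (k : 'I_n -> nat) (x : 'rV[R]_n).

(** The orders [k] are part of the family so that it is stable under partial derivatives:
    differentiating in direction i raises [k i] by one. *)
Definition tens h k x : R := \prod_i derive1n (k i) (h i) (x 0 i).

Lemma continuous_tens h k : (forall i, smooth1 (h i)) -> continuous (tens h k).
Proof.
move=> sh; rewrite /tens; elim: (index_enum _) => [|i r IH] x.
  have -> : (fun x : 'rV[R]_n => \prod_(j <- [::]) derive1n (k j) (h j) (x 0 j)) = cst 1.
    by apply/funext => y; rewrite big_nil.
  exact: cst_continuous.
have -> : (fun x : 'rV[R]_n => \prod_(j <- i :: r) derive1n (k j) (h j) (x 0 j)) =
    (fun x : 'rV[R]_n => derive1n (k i) (h i) (x 0 i) * \prod_(j <- r) derive1n (k j) (h j) (x 0 j)).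
  by apply/funext => y; rewrite big_cons.
apply: (@continuousM _ _ (fun x : 'rV[R]_n => derive1n (k i) (h i) (x 0 i))); last exact: IH.
apply: (@continuous_comp _ _ _ (fun x : 'rV[R]_n => x 0 i) (derive1n (k i) (h i))).
  exact: coord_continuous.
by apply: smooth1_continuous; exact: smooth1_deriven.
Qed.

Lemma is_derive_tens h k i x : (forall i, smooth1 (h i)) ->
  is_derive x (delta_mx 0 i) (tens h k) (tens h (fun j => k j + (j == i))%N x).
Proof.
move=> sh; pose c := \prod_(j | j != i) derive1n (k j) (h j) (x 0 j).
pose g := derive1n (k i) (h i).
have xt (t : R) j : (t *: delta_mx 0 i + x) 0 j = t *+ (j == i) + x 0 j.
  by rewrite !mxE eqxx /= mulr_natr.
have E : (fun t : R => t^-1 *: (tens h k (t *: delta_mx 0 i + x) - tens h k x)) =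
    fun t => c * (t^-1 *: (g (t *: 1 + x 0 i) - g (x 0 i))).
  apply/funext => t; rewrite /tens (bigD1 i)//= [X in _ - X](bigD1 i)//= xt eqxx.
  rewrite [X in _ * X - _](_ : _ = c); last first.
    by apply: eq_bigr => j ji; rewrite xt (negbTE ji) add0r.
  have -> : t *: (1 : R) = t by rewrite -[LHS]/(t * 1) mulr1.
  rewrite -[LHS]/(t^-1 * (g (t + x 0 i) * c - g (x 0 i) * c)).
  by rewrite -[RHS]/(c * (t^-1 * (g (t + x 0 i) - g (x 0 i)))); ring.
have dg : derivable g (x 0 i) 1 by exact: sh.
have H : (fun t : R => t^-1 *: (tens h k (t *: delta_mx 0 i + x) - tens h k x)) @ 0^' --> c * derive1 g (x 0 i).
  by rewrite E; apply: cvgM; [exact: cvg_cst|rewrite derive1E; exact: dg].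
have -> : tens h (fun j => k j + (j == i))%N x = c * derive1 g (x 0 i).
  rewrite /tens (bigD1 i)//= eqxx addn1 derive1nS mulrC; congr (_ * _).
  by apply: eq_bigr => j /negbTE ->; rewrite addn0.
by split; [apply/cvg_ex; eexists; exact: H|apply/cvg_lim => //; exact: H].
Qed.

Lemma pderiv_tens h k i : (forall i, smooth1 (h i)) ->
  pderiv i (tens h k) = tens h (fun j => k j + (j == i))%N.
Proof.
move=> sh; apply/funext => x.
exact: (@derive_val _ _ _ _ _ _ _ (is_derive_tens k i x sh)).
Qed.

Lemma pderivs_tens h s : (forall i, smooth1 (h i)) ->
  pderivs s (tens h (fun=> 0%N)) = tens h (fun j => count_mem j s).
Proof.
move=> sh; elim: s => [//|i s IH] /=.
rewrite [pderivs s _]IH pderiv_tens//; congr tens; apply/funext => j.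
by rewrite addnC eq_sym.
Qed.

Lemma smooth_tens h : (forall i, smooth1 (h i)) -> smooth (tens h (fun=> 0%N)).
Proof.
move=> sh s; rewrite pderivs_tens//; split; first exact: continuous_tens.
by move=> i x; exact: (@ex_derive _ _ _ _ _ _ _ (is_derive_tens _ i x sh)).
Qed.

Lemma mderiv_tens h alpha : (forall i, smooth1 (h i)) ->
  mderiv alpha (tens h (fun=> 0%N)) = tens h alpha.
Proof.
move=> sh; rewrite /mderiv pderivs_tens//; congr tens; apply/funext => j.
rewrite count_flatten -map_comp sumnE big_map big_enum /=.
rewrite (bigD1 j)//= count_nseq /= eqxx mul1n big1 ?addn0// => i ij.
by rewrite count_nseq /= (negbTE ij) mul0n.
Qed.

Lemma pderivs0 s : pderivs s (cst 0) = cst 0 :> ('rV[R]_n -> R).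
Proof.
elim: s => [//|i s IH] /=; rewrite [pderivs s _]IH; apply/funext => x.
by rewrite /pderiv derive_cst.
Qed.

Lemma smooth0 : smooth (cst 0 : 'rV[R]_n -> R).
Proof.
move=> s; rewrite pderivs0; split; first by move=> x; exact: cst_continuous.
by move=> i x; exact: derivable_cst.
Qed.

Lemma csmooth_real (f : 'rV[R]_n -> R) : smooth f -> csmooth (fun x => (f x)%:C).
Proof. by move=> sf; split; [exact: sf|exact: smooth0]. Qed.

Lemma cmderiv_real (f : 'rV[R]_n -> R) alpha x :
  cmderiv alpha (fun x => (f x)%:C) x = (mderiv alpha f x)%:C.
Proof. congr (_ +i* _); exact: (congr1 (fun g => g x) (pderivs0 _)). Qed.

Lemma normc_real (a : R) : @normc R a%:C = `|a|.
Proof. by rewrite /= expr0n /= addr0 sqrtr_sqr. Qed.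

(** Monomials and derivatives both split over the coordinates, so the seminorms are bounded by
    products of suprema of compactly supported continuous functions on the line. *)
Lemma schwartz_tens h : (forall i, smooth1 (h i)) ->
  (forall i, exists a : R, forall y : R, a < `|y| -> h i y = 0) ->
  schwartz (fun x => (tens h (fun=> 0%N) x)%:C).
Proof.
move=> sh h0; split; first exact/csmooth_real/smooth_tens.
move=> alpha beta.
have /choice[M HM] : forall i, exists M : R, forall x : R,
    `|x ^+ alpha i * derive1n (beta i) (h i) x| <= M.
  move=> i; have [a Ha] := h0 i.
  have ch : continuous (fun x : R => x ^+ alpha i * derive1n (beta i) (h i) x).
    move=> x; apply: cvgM; first exact: exprn_continuous.
    by apply: smooth1_continuous; exact: smooth1_deriven.
  have [M HM] := continuous_bounded_itv a ch; exists (Num.max M 0) => x.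
  rewrite le_max; have [xa|xa] := leP `|x| a; first by rewrite HM.
  rewrite (@derive1n_support _ _ (- a) a) ?mulr0 ?normr0 ?lexx ?orbT//.
    by move=> y y1; apply: Ha; rewrite ltNge ler_norml; apply/negP => /andP[]; case: y1; lra.
  by move: xa; rewrite ltNge ler_norml negb_and -!ltNge => /orP[]; [left|right].
exists (\prod_i M i) => x.
rewrite cmderiv_real mderiv_tens// -rmorphM normc_real /tens -big_split /=.
rewrite normr_prod; apply: ler_prod => i _; rewrite normr_ge0 /=; exact: HM.
Qed.

End tensor_smoothness.

(** * Dilation invariance *)

Section dilations.
Context {R : realType}.
Local Open Scope classical_set_scope.
Local Open Scope complex_scope.
Local Open Scope ring_scope.
Local Notation mu := (@lebesgue_measure R).

Lemma bndsupp_dilation (h : R -> R) (w : R) : 0 < w -> bndsupp h ->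
  bndsupp (fun x => h (w * x)).
Proof.
move=> w0 hn; rewrite (_ : (fun x => h (w * x)) = fun x => h (w * x + 0)).
  exact: bndsupp_affine.
by apply/funext => x; rewrite addr0.
Qed.

Lemma smooth1_dilation (h : R -> R) (w : R) : smooth1 h -> smooth1 (fun x => h (w * x)).
Proof.
move=> sh; rewrite (_ : (fun x => h (w * x)) = fun x => h (w * x + 0)).
  exact: smooth1_affine.
by apply/funext => x; rewrite addr0.
Qed.

Lemma derive1n_dilation (h : R -> R) (w : R) k : smooth1 h ->
  derive1n k (fun x => h (w * x)) = fun x => w ^+ k * derive1n k h (w * x).
Proof.
move=> sh; rewrite (_ : (fun x => h (w * x)) = fun x => h (w * x + 0)).
  by rewrite derive1n_affine//; apply/funext => x; rewrite addr0.
by apply/funext => x; rewrite addr0.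
Qed.

Lemma ftrig_dilation t (h : R -> R) (w x : R) : 0 < w -> bndsupp h ->
  ftrig t (fun y => h (w * y)) x = w^-1 * ftrig t h (x / w).
Proof.
move=> w0 hn; rewrite /ftrig.
rewrite -(Rintegral_affine 0 w0 (bndsupp_trigM t (x / w) hn)).
apply: eq_Rintegral => y _; rewrite addr0; congr (trig _ _ * _).
by rewrite mulrA divfK// gt_eqF.
Qed.

Lemma ftrig_scaleM t (h : R -> R) (a x : R) : bndsupp h ->
  ftrig t (fun y => a * h y) x = a * ftrig t h x.
Proof.
move=> hn; rewrite /ftrig -bndsupp_RintegralZ; last exact: bndsupp_trigM.
by apply: eq_Rintegral => y _; rewrite mulrCA.
Qed.

Lemma complex_ext (z z' : R[i]) : complex.Re z = complex.Re z' ->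
  complex.Im z = complex.Im z' -> z = z'.
Proof. by case: z z' => [a b] [a' b'] /= -> ->. Qed.

(** The transform of u(w y) at xi is 1/w times that of [u] at xi/w; the substitution in the inverse
    transform cancels this factor. *)
Lemma multiplier1_dilation (sigma u : R -> R) (w x : R) : 0 < w -> bndsupp sigma -> bndsupp u ->
  multiplier1 (fun xi => sigma (w^-1 * xi)) (fun y => u (w * y)) x = multiplier1 sigma u (w * x).
Proof.
move=> w0 sn un; have w'0 : 0 < w^-1 by rewrite invr_gt0.
have wn0 : w != 0 by rewrite gt_eqF.
have sn' := bndsupp_dilation w'0 sn; have un' := bndsupp_dilation w0 un.
have nF t : bndsupp (fun xi => ftrig t u xi * sigma xi).
  by apply: (bndsuppM sn (measurable_ftrig t un)) => y; exact: ftrig_bounded.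
have E t s : ftrig t (fun xi => ftrig s (fun y => u (w * y)) xi * sigma (w^-1 * xi)) x =
    ftrig t (fun xi => ftrig s u xi * sigma xi) (w * x).
  rewrite (_ : (fun xi => _) = fun xi => w^-1 * (fun z => ftrig s u z * sigma z) (w^-1 * xi)); last first.
    by apply/funext => xi; rewrite ftrig_dilation// (mulrC xi) mulrA.
  rewrite ftrig_scaleM; last exact: (bndsupp_dilation w'0 (nF s)).
  rewrite (ftrig_dilation t x w'0 (nF s)) invrK mulrA mulVf// mul1r.
  by rewrite mulrC.
apply: complex_ext.
  apply: (etrans (multiplier1_ReE sn' un' x));
    apply: (etrans _ (esym (multiplier1_ReE sn un (w * x)))).
  by congr (_ * (_ + _)); exact: E.
apply: (etrans (multiplier1_ImE sn' un' x));
  apply: (etrans _ (esym (multiplier1_ImE sn un (w * x)))).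
by congr (_ * (_ - _)); exact: E.
Qed.

End dilations.

(** * Multipliers of tensor products *)

Section tensor_multipliers.
Context {R : realType} (n : nat).
Local Open Scope classical_set_scope.
Local Open Scope complex_scope.
Local Open Scope ring_scope.
Local Notation Re := (@complex.Re R).
Local Notation Im := (@complex.Im R).

Lemma expiD (a b : R) : expi (a + b) = expi a * expi b.
Proof. by rewrite /expi cosD sinD; apply/eqP;
  rewrite eq_complex /= addrC eqxx /= addrC eqxx. Qed.

Lemma expi_sum (a : 'I_n -> R) : expi (\sum_i a i) = \prod_i expi (a i).
Proof.
elim/big_rec2: _ => [|i y z _ <-]; last by rewrite expiD.
by rewrite /expi cos0 sin0.
Qed.

Lemma real_complex_prod (a : 'I_n -> R) : (\prod_i a i)%:C = \prod_i (a i)%:C.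
Proof. exact: rmorph_prod. Qed.

(** Convertible to [tens h (fun=> 0%N)], so the smoothness lemmas apply to it as they stand. *)
Definition rtens (h : 'I_n -> R -> R) (x : 'rV[R]_n) : R := \prod_i h i (x 0 i).

Lemma fourier_tens (u : 'I_n -> R -> R) xi : (forall i, bndsupp (u i)) ->
  fourier (fun x => (rtens u x)%:C) xi = \prod_i fhat (u i) (xi 0 i).
Proof.
move=> un; rewrite -[RHS](@cintegral_tensor R n (fun i x => expi (- (x * xi 0 i)) * (u i x)%:C)).
  rewrite /fourier; congr cintegral; apply/funext => x.
  by rewrite /dotp -sumrN expi_sum /rtens real_complex_prod big_split.
by move=> i; exact: cbndsupp_fourier_kernel.
Qed.

Lemma cintegralZ (c : R) (f : 'rV[R]_n -> R[i]) : cbndsupp_rV f ->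
  cintegral (fun x => c%:C * f x) = c%:C * cintegral f.
Proof.
move=> [nR nI]; rewrite /cintegral.
transitivity ((c * \int[lebesgue_rV n]_x (Re (f x))) +i* (c * \int[lebesgue_rV n]_x (Im (f x)))).
  congr (_ +i* _).
    rewrite -RintegralZl//; last exact: (bndsupp_rV_integrable nR).
    by apply: eq_Rintegral => x _; rewrite ReM /= mul0r subr0.
  rewrite -RintegralZl//; last exact: (bndsupp_rV_integrable nI).
  by apply: eq_Rintegral => x _; rewrite ImM /= mul0r addr0.
by apply/eqP; rewrite eq_complex /= !mul0r subr0 addr0 !eqxx.
Qed.

Lemma multiplier_tens (c : R) (sigma u : 'I_n -> R -> R) x :
  (forall i, bndsupp (sigma i)) -> (forall i, bndsupp (u i)) ->
  multiplier (fun xi => (c * rtens sigma xi)%:C) (fun x => (rtens u x)%:C) x =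
  c%:C * \prod_i multiplier1 (sigma i) (u i) (x 0 i).
Proof.
move=> sn un; rewrite /multiplier.
pose K i xi := expi (xi * x 0 i) * (sigma i xi)%:C * fhat (u i) xi.
have nK i : cbndsupp (K i) by exact: cbndsupp_multiplier_kernel.
rewrite (_ : (fun xi => _) = fun xi : 'rV[R]_n => c%:C * \prod_i K i (xi 0 i)); last first.
  apply/funext => xi; rewrite fourier_tens// /dotp expi_sum rmorphM /= /rtens real_complex_prod.
  by rewrite !big_split /=; ring.
rewrite cintegralZ; last exact: (cintegral_tensor_aux nK).1.
rewrite (cintegral_tensor nK) mulrCA; congr (_ * _).
rewrite /multiplier1 big_split /=; congr (_ * _).
by rewrite prodr_const card_ord -exprVn rmorphXn.
Qed.

End tensor_multipliers.

(** * A multiplier adapted to a given box *)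

Section box_multipliers.
Context {R : realType}.
Local Open Scope classical_set_scope.
Local Open Scope complex_scope.
Local Open Scope ring_scope.

Lemma pderivsZ n (c : R) (f : 'rV[R]_n -> R) s : smooth f ->
  pderivs s (fun x => c * f x) = fun x => c * pderivs s f x.
Proof.
move=> sf; elim: s => [//|i s IH] /=.
rewrite [pderivs s _]IH; apply/funext => x.
exact: (deriveZ c ((sf s).2 i x)).
Qed.

Lemma smoothZ n (c : R) (f : 'rV[R]_n -> R) : smooth f -> smooth (fun x => c * f x).
Proof.
move=> sf s; rewrite pderivsZ//; split.
  move=> x; apply: (@continuousM _ _ (cst c) (pderivs s f)); first exact: cst_continuous.
  exact: (sf s).1.
by move=> i x; apply: (@derivableZ _ _ _ (pderivs s f) c x); exact: (sf s).2.
Qed.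

(** Rudin-Shapiro lengths are powers of 2; rounding l/w down to one loses a factor 2, whence the
    quotients l/(2w) in the sequel. *)
Lemma exists_dyadic (l w : R) : 0 < w -> w <= l ->
  exists m : nat, (2 ^ m)%:R * w <= l /\ l < 2 * ((2 ^ m)%:R * w).
Proof.
move=> w0 wl; pose r := l / w; have r1 : 1 <= r by rewrite ler_pdivlMr ?mul1r.
have r0 : 0 <= r by lra.
have /andP[t1 t2] := truncn_itv r0; set t := Num.truncn r in t1 t2.
have t0 : (0 < t)%N by rewrite -(ltr_nat R); rewrite -natr1 in t2; lra.
have /andP[m1 m2] := trunc_log_bounds (erefl : (1 < 2)%N) t0.
exists (trunc_log 2 t); split.
  by rewrite -ler_pdivlMr//; apply: le_trans t1; rewrite ler_nat.
rewrite mulrA -ltr_pdivrMr//; apply: lt_le_trans t2 _.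
by rewrite -natrM ler_nat -expnS.
Qed.

(** Uniformity in [m] and [q] is what yields constants common to the whole sequence of symbols. *)
Lemma derive1n_symb_bounded : exists M : nat -> R,
  forall k, 0 <= M k /\ forall m q x, `|derive1n k (symb m q) x| <= M k.
Proof.
have /choice[M HM] : forall k, exists M : R, forall x : R, `|derive1n k bump x| <= M.
  move=> k; have ck : continuous (derive1n k (@bump R)).
    by apply: smooth1_continuous; apply: smooth1_deriven; exact: smooth1_bump.
  have [M HM] := continuous_bounded_itv 1 ck; exists (Num.max M 0) => x.
  rewrite le_max; have [x1|x1] := leP `|x| 1; first by rewrite HM.
  by rewrite derive1n_bump_supp// normr0 lexx orbT.
exists (fun k => 2 * (16 ^+ k * M k)) => k; split; last first.
  by move=> m q x; exact: derive1n_symb_le.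
by rewrite !mulr_ge0// ?exprn_ge0//; exact: le_trans (normr_ge0 _) (HM k 0).
Qed.

(** The first factor comes from the bound 1/[bump_mass] on [bump] and from [conc_wave_norms], the
    factor 1/(2 pi) from the inversion formula, and 1/128 from [pairing_ge]. *)
Definition norm_const : R := bump_mass^-1 ^- 2 / 4 * ((2 * pi)^-1 / 128).

Lemma norm_const_gt0 : 0 < norm_const.
Proof.
have pi0 : 0 < pi :> R by exact: pi_gt0.
apply: mulr_gt0.
  by apply: divr_gt0 => //; rewrite invr_gt0 exprn_gt0// invr_gt0; exact: bump_mass_gt0.
by apply: divr_gt0 => //; rewrite invr_gt0; exact: mulr_gt0.
Qed.

Lemma Lp1_normr (p : R) (f : R -> R) : Lp1 p (fun x => `|f x|) = Lp1 p f.
Proof. by rewrite /Lp1 -[RHS]Lnorm_abse. Qed.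

Lemma Lp_normZ n (p c : R) (f : 'rV[R]_n -> R[i]) : 0 < p -> 0 <= c ->
  measurable_fun setT (@normc R \o f) ->
  Lp_norm p (fun x => c%:C * f x) = (c%:E * Lp_norm p f)%E.
Proof.
move=> p0 c0 mf; rewrite /Lp_norm unlock.
have mfp := measurable_abse_poweR p mf.
transitivity ((\int[lebesgue_rV n]_x ((c `^ p)%:E * `|(EFin \o (@normc R \o f)) x| `^ p)) `^ p^-1)%E.
  congr (_ `^ _)%E; apply: eq_integral => x _.
  by rewrite normcM normc_real ger0_norm// EFinM abseM poweRM ?abse_ge0// gee0_abs.
have I0 : (0 <= \int[lebesgue_rV n]_x `|(EFin \o (@normc R \o f)) x| `^ p)%E.
  by apply: integral_ge0 => x _; exact: poweR_ge0.
rewrite ge0_integralZl//; last 2 first.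
- by move=> x _; exact: poweR_ge0.
- by rewrite lee_fin powR_ge0.
rewrite poweRM// ?lee_fin ?powR_ge0//; congr (_ * _)%E.
by rewrite poweR_EFin -powRrM mulfV ?gt_eqF// powRr1.
Qed.

Lemma measurable_normc_prod n (f : 'I_n -> R -> R[i]) :
  (forall i, measurable_fun setT (@normc R \o f i)) ->
  measurable_fun setT (@normc R \o (fun x : 'rV[R]_n => \prod_i f i (x 0 i))).
Proof.
move=> mf; apply/measurable_EFinP.
rewrite (_ : _ \o _ = fun x : 'rV[R]_n => \prod_i (EFin \o (@normc R \o f i)) (x 0%R i))%E.
  apply: (@integral_tensor R n (fun i => EFin \o (@normc R \o f i)) _ _).1 => [i|i x].
    by apply/measurable_EFinP; exact: mf.
  by rewrite /= lee_fin; exact: le_trans (normr_ge0 _) (Re_le_normc _).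
by apply/funext => x; rewrite /= normc_prod prodEFin.
Qed.

Lemma lee_prod n (a b : 'I_n -> \bar R) : (forall i, (0 <= a i)%E) ->
  (forall i, (a i <= b i)%E) -> (\prod_i a i <= \prod_i b i)%E.
Proof.
elim: n a b => [|n IH] a b a0 ab; first by rewrite !big_ord0.
rewrite !big_ord_recl; apply: lee_pmul => //.
  by apply: prode_ge0 => i _; exact: a0.
exact: IH.
Qed.

(** The supremum is tested on the tensor product of the [u i], for which both norms factor; it is a
    nonzero function because its norm is positive. *)
Lemma op_norm_tens n (p c : R) (sigma u : 'I_n -> R -> R) (k : 'I_n -> R) :
  0 < p -> 0 <= c -> (forall i, bndsupp (sigma i)) -> (forall i, smooth1 (u i)) ->
  (forall i, exists a : R, forall y : R, a < `|y| -> u i y = 0) ->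
  (forall i, 0 < Lp1 p (u i))%E -> (forall i, 0 <= k i) ->
  (forall i, ((k i)%:E * Lp1 p (u i) <= Lp1 p (@normc R \o multiplier1 (sigma i) (u i)))%E) ->
  ((c * \prod_i k i)%:E <= op_norm p (fun x => (c * rtens sigma x)%:C))%E.
Proof.
move=> p0 c0 sn su u0 up k0 H.
have un i : bndsupp (u i).
  have [a Ha] := u0 i; apply: (@bndsupp_continuous _ _ a) => //.
  exact: smooth1_continuous.
pose b i := fine (Lp1 p (u i)).
have bE i : Lp1 p (u i) = (b i)%:E.
  rewrite fineK// ge0_fin_numE ?Lp1_fin//; exact: Lnorm_ge0.
have b0 i : 0 < b i by rewrite -lte_fin -bE.
have Eu : Lp_norm p (fun x => (rtens u x)%:C) = (\prod_i b i)%:E.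
  rewrite (_ : (fun x => _) = fun x : 'rV[R]_n => \prod_i (u i (x 0 i))%:C); last first.
    by apply/funext => x; rewrite /rtens real_complex_prod.
  have nE i : @normc R \o (fun y => (u i y)%:C) = fun y => `|u i y|.
    by apply/funext => y; exact: normc_real.
  rewrite (Lp_norm_tensor p (f := fun i y => (u i y)%:C)); last first.
    by move=> i; rewrite nE; apply: bndsupp_measurable; exact: bndsupp_norm.
  by rewrite -prodEFin; apply: eq_bigr => i _; rewrite nE Lp1_normr.
have pb : 0 < \prod_i b i by apply: prodr_gt0.
have ET : ((c * \prod_i (k i * b i))%:E <=
    Lp_norm p (multiplier (fun xi => (c * rtens sigma xi)%:C) (fun x => (rtens u x)%:C)))%E.
  rewrite (_ : multiplier _ _ = fun x => c%:C * \prod_i multiplier1 (sigma i) (u i) (x 0 i)); last first.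
    by apply/funext => x; exact: multiplier_tens.
  have mT i := measurable_multiplier1_norm (sn i) (un i).
  rewrite Lp_normZ//; last exact: (@measurable_normc_prod n (fun i => multiplier1 (sigma i) (u i)) mT).
  rewrite (@Lp_norm_tensor R n p (fun i => multiplier1 (sigma i) (u i)) mT) EFinM;
    apply: lee_wpmul2l; first by rewrite lee_fin.
  rewrite -prodEFin; apply: lee_prod => i; first by rewrite lee_fin mulr_ge0// ltW.
  by rewrite EFinM -bE.
apply: (@le_trans _ _ (Lp_norm p (multiplier (fun xi => (c * rtens sigma xi)%:C)
    (fun x => (rtens u x)%:C)) / Lp_norm p (fun x => (rtens u x)%:C))%E); last first.
  apply: ereal_sup_ubound; exists (fun x => (rtens u x)%:C) => //; split.
    exact: (schwartz_tens su u0).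
  move=> uz; have : Lp_norm p (fun x => (rtens u x)%:C) = 0%E.
    rewrite uz /Lp_norm (_ : (fun x : 'rV[R]_n => _) = cst 0%E); last first.
      by apply/funext => x; rewrite /= expr0n /= addr0 sqrtr0.
    by rewrite Lnorm0// eqe gt_eqF.
  by rewrite Eu => -[] /eqP; rewrite gt_eqF.
rewrite Eu inver gt_eqF//.
apply: (@le_trans _ _ ((c * \prod_i (k i * b i))%:E * ((\prod_i b i)^-1)%:E)%E).
  rewrite -EFinM lee_fin big_split /= mulrA mulfK//; exact: lt0r_neq0.
by apply: lee_wpmul2r => //; rewrite lee_fin invr_ge0 ltW.
Qed.

Lemma powR_prod n (a : 'I_n -> R) (r : R) : (forall i, 0 <= a i) ->
  (\prod_i a i) `^ r = \prod_i (a i `^ r).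
Proof.
elim: n a => [|n IH] a a0; first by rewrite !big_ord0 powR1.
by rewrite !big_ord_recl powRM ?IH//; apply: prodr_ge0 => i _; exact: a0.
Qed.

(** Coordinate i carries a line symbol with 2^(m i) bumps dilated by [w i]: each derivative costs a
    factor 1/[w i], and the support lies in |x_i| <= 2^(m i) w_i <= l_i. *)
Lemma box_multiplier n (p c0 : R) (M : nat -> R) (l w : 'I_n -> R) : 1 < p -> 0 <= c0 ->
  (forall k, 0 <= M k /\ forall m q x, `|derive1n k (symb m q) x| <= M k) ->
  (forall i, 0 < w i) -> (forall i, w i <= l i) ->
  exists sigma : 'rV[R]_n -> R[i], [/\ csmooth sigma,
    forall alpha x, normc (cmderiv alpha sigma x) <=
      c0 * \prod_i (w i ^- alpha i * M (alpha i)),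
    forall alpha x, ~ interval_rV l x -> cmderiv alpha sigma x = 0 &
    ((c0 * (norm_const ^+ n * (\prod_i (l i / (2 * w i))) `^ `|p^-1 - 2^-1|))%:E <=
      op_norm p sigma)%E].
Proof.
move=> p1 c00 HM w0 wl; have p0 : 0 < p := lt_trans ltr01 p1.
have /choice[m Hm] := fun i => exists_dyadic (w0 i) (wl i).
have /choice[q Hq] := fun i => @one_dimensional_bound R (m i) p p1.
have /choice[u Hu] := Hq.
pose s i x := symb (m i) (q i) ((w i)^-1 * x).
pose v i x := u i (w i * x).
have w'0 i : 0 < (w i)^-1 by rewrite invr_gt0.
have ss i : smooth1 (s i) by apply: smooth1_dilation; exact: smooth1_symb.
have sn i : bndsupp (s i) by apply: bndsupp_dilation => //; exact: bndsupp_symb.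
have un i : bndsupp (u i).
  have [su [a ua] _ _] := Hu i; apply: (@bndsupp_continuous _ _ a) => //.
  exact: smooth1_continuous.
have sE k i x : derive1n k (s i) x = (w i) ^- k * derive1n k (symb (m i) (q i)) ((w i)^-1 * x).
  by rewrite derive1n_dilation ?exprVn//; exact: smooth1_symb.
have dE alpha x : cmderiv alpha (fun x => (c0 * rtens s x)%:C) x = (c0 * tens s alpha x)%:C.
  by rewrite cmderiv_real /mderiv (pderivsZ c0 _ (smooth_tens ss)) -/(mderiv _ _) mderiv_tens.
exists (fun x => (c0 * rtens s x)%:C); split.
- apply: csmooth_real; apply: smoothZ; exact: (smooth_tens ss).
- move=> alpha x; rewrite dE normc_real normrM (ger0_norm c00) ler_wpM2l//.
  rewrite normr_prod; apply: ler_prod => i _; rewrite normr_ge0 /= sE normrM.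
  have wa : 0 <= w i ^- alpha i by rewrite invr_ge0 exprn_ge0// ltW.
  by rewrite (ger0_norm wa); apply: ler_wpM2l => //; apply (HM _).2.
- move=> alpha x nx; rewrite dE.
  have [i xi] : exists i, l i < `|x 0 i|.
    apply/not_existsP => H; apply: nx => i.
    by rewrite leNgt; apply/negP; exact: H.
  rewrite /tens (bigD1 i)//= sE derive1n_symb_supp ?mulr0 ?mul0r ?mulr0//.
  rewrite normrM gtr0_norm// mulrC ltr_pdivlMr//.
  exact: le_lt_trans (Hm i).1 xi.
set g := `|p^-1 - 2^-1|.
apply: (@le_trans _ _ (c0 * \prod_i (norm_const * (2 ^ m i)%:R `^ g))%:E).
  have E (K : R) (a : 'I_n -> R) : \prod_i (K * a i) = K ^+ n * \prod_i a i.
    by rewrite big_split /= prodr_const card_ord.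
  rewrite lee_fin E; apply: ler_wpM2l => //.
  apply: ler_wpM2l; first by rewrite exprn_ge0// ltW// norm_const_gt0.
  rewrite -powR_prod//.
  apply: ge0_ler_powR; rewrite ?nnegrE ?normr_ge0//.
  - by apply: prodr_ge0 => i _; rewrite divr_ge0 ?mulr_ge0 ?ltW// (lt_le_trans (w0 i)).
  - by apply: prodr_ge0.
  apply: ler_prod => i _; apply/andP; split.
    by rewrite divr_ge0 ?mulr_ge0 ?ltW// (lt_le_trans (w0 i)).
  rewrite ler_pdivrMr ?mulr_gt0//; have [_ h] := Hm i; apply: le_trans (ltW h) _.
  by rewrite mulrCA.
apply: (op_norm_tens (u := v) p0 c00 sn).
- by move=> i; have [su _ _ _] := Hu i; exact: smooth1_dilation.
- move=> i; have [_ [a ua] _ _] := Hu i; exists (a / w i) => y.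
  by rewrite ltr_pdivrMr// => ay; apply: ua; rewrite normrM gtr0_norm// mulrC.
- move=> i; have [_ _ up _] := Hu i; rewrite /v Lp1_scale//; last exact: bndsupp_measurable.
  by rewrite mule_gt0// lte_fin powR_gt0.
- by move=> i; rewrite mulr_ge0 ?powR_ge0// ltW// norm_const_gt0.
move=> i; have [_ _ _ H] := Hu i.
have nsy : bndsupp (symb (m i) (q i) : R -> R) by exact: bndsupp_symb.
have E1 := Lp1_scale p0 (w0 i) (bndsupp_measurable (un i)).
have E2 := Lp1_scale p0 (w0 i) (measurable_multiplier1_norm nsy (un i)).
have E3 : @normc R \o multiplier1 (s i) (v i) =
    fun x => (@normc R \o multiplier1 (symb (m i) (q i)) (u i)) (w i * x).
  apply/funext => x; exact: (congr1 (@normc R) (multiplier1_dilation x (w0 i) nsy (un i))).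
(* Input and output are dilated by the same [w i], so both norms acquire the same factor. *)
rewrite E3 [leRHS]E2.
rewrite -[Lp1 p (v i)]/(Lp1 p (fun x => u i (w i * x))) E1.
rewrite muleCA; apply: lee_wpmul2l; [by rewrite lee_fin powR_ge0|exact: H].
Qed.

End box_multipliers.

(** * From boxes to the function F_p *)

Lemma inf_image_ge0 (T : Type) (R : realType) (A : set T) (f : T -> R) :
  A !=set0 -> (forall x, 0 < f x) -> 0 <= inf (f @` A).
Proof.
move=> [x Ax] f0; apply: lb_le_inf; first by exists (f x), x.
by move=> _ [y _ <-]; exact: ltW.
Qed.

Lemma inf_image_le (T : Type) (R : realType) (A : set T) (f : T -> R) x :
  A x -> (forall x, 0 < f x) -> inf (f @` A) <= f x.
Proof.
move=> Ax f0; apply: ge_inf; last by exists x.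
by exists 0 => _ [y _ <-]; exact: ltW.
Qed.

Lemma lebesgue_rV_interval (R : realType) (n : nat) (l : 'I_n -> R) :
  (forall i, 0 <= l i) ->
  lebesgue_rV n (interval_rV l) = (\prod_i (l i + l i))%:E.
Proof.
move=> l0; have -> : interval_rV l = [set x | forall i, [set` `[- l i, l i]%R] (x 0 i)].
  by apply/seteqP; split=> x Hx i; have := Hx i; rewrite /= in_itv/= -ler_norml.
rewrite (lebesgue_rV_box (A := fun i => [set` `[- l i, l i]%R])); last first.
  by move=> i; exact: measurable_itv.
rewrite -prodEFin; apply: eq_bigr => i _.
rewrite lebesgue_measure_itv/= lte_fin; case: ifPn => [_|]; first by rewrite -EFinB opprK.
by rewrite -leNgt => H; congr EFin; have := l0 i; lra.
Qed.

Section construction.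
Context {R : realType} {n : nat}.
Variables (p : R) (lam : 'rV[R]_n -> R) (psi : 'I_n -> 'rV[R]_n -> R) (c C : R).
Hypotheses (p1 : 1 < p) (lam_gt0 : forall xi, 0 < lam xi).
Hypotheses (psi_gt0 : forall j xi, 0 < psi j xi) (c_gt0 : 0 < c) (C_gt0 : 0 < C).

Let g : R := `|p^-1 - 2^-1|.
Let D : R := (C * (4 * c) ^+ n) `^ g.

(** The interval has volume the product of the 2 l_j, and 2 l_j / psi_j = 4c times l_j / (2 c
    psi_j), the quotient bounded by the operator norm in [box_multiplier]. This is the origin of
    [D]. *)
Lemma Fp_le (xi : 'rV[R]_n) (l : 'I_n -> R) :
  (forall j, c * psi j xi <= l j) ->
  (lebesgue_rV n (Sset psi xi) <= C%:E * lebesgue_rV n (interval_rV l))%E ->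
  (Fp p lam psi xi <= (inf (lam @` Sset psi xi) *
     (D * (\prod_j (l j / (2 * (c * psi j xi)))) `^ g))%:E)%E.
Proof.
move=> cl muS.
have w0 j : 0 < c * psi j xi by rewrite mulr_gt0.
have l0 j : 0 < l j := lt_le_trans (w0 j) (cl j).
have X0 : 0 <= \prod_j (l j / (2 * (c * psi j xi))).
  by apply: prodr_ge0 => j _; rewrite divr_ge0 ?mulr_ge0 ?ltW.
have P0 : 0 <= \prod_j (psi j xi)^-1 by apply: prodr_ge0 => j _; rewrite invr_ge0 ltW.
have C0 : 0 <= C * (4 * c) ^+ n by rewrite mulr_ge0 ?exprn_ge0 ?mulr_ge0 ?ltW.
rewrite /Fp EFinM; apply: lee_wpmul2l.
  by rewrite lee_fin; apply: inf_image_ge0 => //; exists xi => j.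
rewrite /D -powRM// -poweR_EFin; apply: le_poweR; first exact: normr_ge0.
  by rewrite mule_ge0// measure_ge0.
apply: (@le_trans _ _ (C%:E * lebesgue_rV n (interval_rV l) * (\prod_j (psi j xi)^-1)%:E)%E).
  by apply: lee_wpmul2r => //; rewrite lee_fin.
rewrite lebesgue_rV_interval; last by move=> j; exact: ltW.
have E : (\prod_j (l j + l j)) * \prod_j (psi j xi)^-1 =
    (4 * c) ^+ n * \prod_j (l j / (2 * (c * psi j xi))).
  rewrite -[X in _ ^+ X]card_ord -prodr_const -!big_split /=; apply: eq_bigr => j _.
  by field; rewrite !lt0r_neq0.
by rewrite -!EFinM -mulrA E mulrA.
Qed.

(** At a point eta of the interval, hence of S(xi), the height inf lambda is at most lambda(eta),
    and (c psi_j(xi))^-1 is at most (c psi_j(eta))^-1. Outside the interval all derivatives vanish.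
    So bounds frozen at xi become bounds at eta. *)
Lemma exists_symbol (M : nat -> R) :
  (forall k, 0 <= M k /\ forall m q x, `|derive1n k (symb m q) x| <= M k) ->
  forall (xi : 'rV[R]_n) (l : 'I_n -> R),
  (forall j, c * psi j xi <= l j) -> interval_rV l `<=` Sset psi xi ->
  (lebesgue_rV n (Sset psi xi) <= C%:E * lebesgue_rV n (interval_rV l))%E ->
  exists sigma : 'rV[R]_n -> R[i], [/\ csmooth sigma,
    forall alpha eta, normc (cmderiv alpha sigma eta) <=
      \prod_j (c ^- alpha j * M (alpha j)) * lam eta * weight psi alpha eta &
    (Fp p lam psi xi <= (D / norm_const ^+ n)%:E * op_norm p sigma)%E].
Proof.
move=> HM xi l cl IS muS.
have w0 j : 0 < c * psi j xi by rewrite mulr_gt0.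
have S0 : Sset psi xi !=set0 by exists xi => j.
have i0 := inf_image_ge0 S0 lam_gt0.
have [sigma [ssm sle s0 sop]] := box_multiplier p1 i0 HM w0 cl.
exists sigma; split=> // [alpha eta|].
  have K0 : 0 <= \prod_j (c ^- alpha j * M (alpha j)).
    by apply: prodr_ge0 => j _; rewrite mulr_ge0 ?(HM _).1// invr_ge0 exprn_ge0 ?ltW.
  have W0 : 0 <= weight psi alpha eta.
    by apply: prodr_ge0 => j _; rewrite invr_ge0 exprn_ge0 ?ltW.
  have [ein|eout] := pselect (interval_rV l eta); last first.
    rewrite s0// normc0; apply: mulr_ge0 => //; apply: mulr_ge0 => //; exact: ltW.
  have eS := IS _ ein.
  apply: le_trans (sle alpha eta) _.
  rewrite [leRHS]mulrAC [leRHS]mulrC; apply: ler_pM => //.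
  - by apply: prodr_ge0 => j _; rewrite mulr_ge0 ?(HM _).1// invr_ge0 exprn_ge0 ?ltW.
  - exact: inf_image_le.
  rewrite /weight -big_split /=; apply: ler_prod => j _; apply/andP; split.
    by rewrite mulr_ge0 ?(HM _).1// invr_ge0 exprn_ge0 ?ltW.
  rewrite [leRHS]mulrAC; apply: ler_wpM2r; first exact: (HM _).1.
  rewrite exprMn invfM ler_pM2l ?invr_gt0 ?exprn_gt0//.
  rewrite lef_pV2 ?posrE ?exprn_gt0//; apply: lerXn2r; rewrite ?nnegrE;
    [exact: ltW|exact: ltW|exact: eS].
apply: le_trans (Fp_le cl muS) _.
have K0 : 0 < norm_const ^+ n :> R by rewrite exprn_gt0// norm_const_gt0.
have D0 : 0 <= D by exact: powR_ge0.
have DK0 : (0 <= (D / norm_const ^+ n)%:E)%E.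
  by rewrite lee_fin divr_ge0 // ltW.
apply: le_trans (lee_wpmul2l DK0 sop).
rewrite -EFinM lee_fin le_eqVlt; apply/orP; left; apply/eqP.
by field; exact: lt0r_neq0.
Qed.

End construction.

Theorem theorem1p4 (R : realType) (n : nat) (hn : (1 <= n)%N)
  (p : R) (hp1 : 1 < p) (hp2 : p <> 2)
  (lam : 'rV[R]_n -> R) (lam_gt0 : forall xi, 0 < lam xi)
  (lam_cont : continuous lam)
  (lam_bounded : exists M : R, forall xi, lam xi <= M)
  (psi : 'I_n -> 'rV[R]_n -> R) (psi_gt0 : forall j xi, 0 < psi j xi)
  (psi_cont : forall j, continuous (psi j))
  (c C : R) (c_gt0 : 0 < c) (C_gt0 : 0 < C)
  (hI : forall xi : 'rV[R]_n, C <= enorm xi ->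
    exists l : 'I_n -> R,
      [/\ forall j, c * psi j xi <= l j,
          interval_rV l `<=` Sset psi xi &
          (lebesgue_rV n (Sset psi xi) <=
           C%:E * lebesgue_rV n (interval_rV l))%E])
  (F_unbounded : ~ exists M : R, forall xi : 'rV[R]_n, C <= enorm xi ->
    (`|Fp p lam psi xi| <= M%:E)%E) :
  exists (sigma : nat -> 'rV[R]_n -> complex R) (Ca : multi_index n -> R),
    [/\ forall k, symbol_class lam psi (sigma k),
        forall alpha, 0 <= Ca alpha,
        forall xi alpha k,
          normc (cmderiv alpha (sigma k) xi) <=
          Ca alpha * lam xi * weight psi alpha xi &
        (fun k => op_norm p (sigma k)) @ \oo --> +oo%E].
Proof.
have [M HM] := @derive1n_symb_bounded R.
pose Ca (alpha : multi_index n) := \prod_j (c ^- alpha j * M (alpha j)).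
have Ca0 alpha : 0 <= Ca alpha.
  by apply: prodr_ge0 => j _; rewrite mulr_ge0 ?(HM _).1// invr_ge0 exprn_ge0 ?ltW.
(* The ratio in [exists_symbol] between F_p(xi) and the norm of the operator built at xi. *)
pose K : R := (C * (4 * c) ^+ n) `^ `|p^-1 - 2^-1| / norm_const ^+ n.
have K0 : 0 < K.
  by rewrite divr_gt0 ?exprn_gt0 ?norm_const_gt0// powR_gt0// mulr_gt0// exprn_gt0// mulr_gt0.
have step (k : nat) : exists sigma : 'rV[R]_n -> R[i], [/\ csmooth sigma,
    forall alpha eta, normc (cmderiv alpha sigma eta) <=
      Ca alpha * lam eta * weight psi alpha eta &
    ((k%:R / K)%:E <= op_norm p sigma)%E].
  (* Choosing xi with F_p(xi) > k gives norms of at least k/K, so the entire sequence diverges and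
     no subsequence has to be extracted. *)
  have [xi [Cxi kF]] : exists xi, C <= enorm xi /\ (k%:R%:E < `|Fp p lam psi xi|)%E.
    apply: contrapT => H; apply: F_unbounded; exists k%:R => xi Cxi.
    by rewrite leNgt; apply/negP => kF; apply: H; exists xi.
  have [l [cl IS muS]] := hI xi Cxi.
  have [sigma [ssm sle sop]] := exists_symbol hp1 lam_gt0 psi_gt0 c_gt0 C_gt0 HM cl IS muS.
  exists sigma; split=> //.
  have F0 : (0 <= Fp p lam psi xi)%E.
    rewrite /Fp mule_ge0 ?poweR_ge0// lee_fin; apply: inf_image_ge0 => //.
    by exists xi => j.
  rewrite gee0_abs// in kF.
  have := le_trans (ltW kF) sop; rewrite -/K.
  by rewrite (EFinM k%:R K^-1) lee_pdivrMr// (muleC (op_norm p sigma)).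
have /choice[sigma Hs] := step.
exists sigma, Ca; split=> //.
- move=> k; have [s1 s2 _] := Hs k; split=> // alpha; exists (Ca alpha) => //; exact: s2.
- by move=> xi alpha k; have [_ s2 _] := Hs k; exact: s2.
apply/cvgeyPge => A; near=> k; have [_ _] := Hs k; apply: le_trans.
rewrite lee_fin ler_pdivlMr//; near: k; exact: nbhs_infty_ger.
Unshelve. all: by end_near.
Qed.
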